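(* Let $P$ be a probability distribution on $\mathbb{R}^d$ with volume dimension $d_{\mathrm{vol}}=d_{\mathrm{vol}}(P)$ (relative to the fixed set $\mathbb{X}\subset\mathbb{R}^d$), let $X_1,\dots,X_n$ be i.i.d. from $P$, and let $l_n>0$ and $\delta\in(0,1)$. Let $K:\mathbb{R}^d\to\mathbb{R}$ be a kernel function such that: (i) (integrability) $\|K\|_\infty<\infty$, and either $d_{\mathrm{vol}}=0$ or $\int_0^\infty t^{d_{\mathrm{vol}}-1}\sup_{\|x\|\ge t}|K(x)|^2\,dt<\infty$; (ii) (VC condition) $\|K\|_\infty,\|K\|_2<\infty$ and $\mathcal{F}_{K,[l_n,\infty)}=\{K_{x,h}:x\in\mathbb{X},\,h\ge l_n\}$ is a uniformly bounded VC-class with dimension $\nu$, i.e. there exist positive numbers $A$ and $\nu$ such that, for every probability measure $Q$ on $\mathbb{R}^d$ and every $\eta\in(0,\|K\|_\infty)$, $\mathcal{N}(\mathcal{F}_{K,[l_n,\infty)},L_2(Q),\eta)\le\left(\frac{A\|K\|_\infty}{\eta}\right)^{\nu}$. Then, with probability at least $1-\delta$, $$\sup_{h\ge l_n,\,x\in\mathbb{X}}|\hat p_h(x)-p_h(x)|\le C\left(\frac{(\log(1/l_n))_+}{n l_n^{d}}+\sqrt{\frac{(\log(1/l_n))_+}{n l_n^{2d-d_{\mathrm{vol}}+\epsilon}}}+\sqrt{\frac{\log(2/\delta)}{n l_n^{2d-d_{\mathrm{vol}}+\epsilon}}}+\frac{\log(2/\delta)}{n l_n^{d}}\right)$$ for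 any $\epsilon\in(0,d_{\mathrm{vol}})$, where $C$ is a constant depending only on $A$, $\|K\|_\infty$, $d$, $\nu$, $d_{\mathrm{vol}}$, $C_{2,P,K,\epsilon}$, $\epsilon$. Further, if $d_{\mathrm{vol}}=0$, or if $\limsup_{r\to0}\sup_{x\in\mathbb{X}}\frac{P(\mathbb{B}_{\mathbb{R}^d}(x,r))}{r^{d_{\mathrm{vol}}}}<\infty$, then $\epsilon$ can be $0$ in this bound.
   Context: A subset $\mathbb{X}\subset\mathbb{R}^d$ is fixed. $\|\cdot\|$ is the Euclidean norm and $\mathbb{B}_{\mathbb{R}^d}(x,r)=\{y\in\mathbb{R}^d:\|y-x\|<r\}$. The volume dimension of $P$ is $$d_{\mathrm{vol}}(P)=\sup\left\{\nu\ge0:\ \limsup_{r\to0}\sup_{x\in\mathbb{X}}\frac{P(\mathbb{B}_{\mathbb{R}^d}(x,r))}{r^\nu}<\infty\right\}.$$ Kernel density estimator: $\hat p_h(x)=\frac{1}{nh^d}\sum_{i=1}^nK\left(\frac{x-X_i}{h}\right)$, and $p_h(x)=\mathbb{E}[\hat p_h(x)]$. $K_{x,h}(\cdot)=K\left(\frac{x-\cdot}{h}\right)$. $(a)_+=\max(a,0)$. $\|K\|_\infty$ is the sup norm and $\|K\|_2$ the $L_2$ norm. The covering number $\mathcal{N}(\mathcal{F},L_2(Q),\eta)$ is the minimal number of open $L_2(Q)$-balls of radius $\eta$ with centers in $\mathcal{F}$ needed to cover $\mathcal{F}$. $C_{2,P,K,\epsilon}$ denotes a constant, depending only on $P$, $K$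 and $\epsilon$, such that $\mathbb{E}_P\left[K\left(\frac{x-X}{h}\right)^2\right]\le C_{2,P,K,\epsilon}\,h^{d_{\mathrm{vol}}-\epsilon}$ for $x\in\mathbb{X}$, $h>0$, $X\sim P$; such a constant exists under (i).
   Formalization: X is assumed Borel (otherwise the event may have no defined probability), and 2d − d_vol + ε ≥ 0 is assumed (automatic if P(X) > 0); without the latter the bound fails, e.g. X = {0} with density proportional to |y|^{3d} near 0. *)

(* Defs.v *)
From HB Require Import structures.
From mathcomp Require Import all_boot all_order all_algebra.
From mathcomp Require Import all_classical all_reals all_analysis.

Set Implicit Arguments.
Unset Strict Implicit.
Unset Printing Implicit Defensive.

Import Order.TTheory GRing.Theory Num.Theory.
Import numFieldNormedType.Exports.

Local Open Scope classical_set_scope.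
Local Open Scope ring_scope.

Definition rV_display : measure_display. Proof. exact: default_measure_display. Qed.

(* The product sigma-algebra of the coordinates, i.e. the Borel sigma-algebra
   of R^d (same construction as the library's instance on tuples). *)
Section measurable_rV.
Context {R : realType}.
Variable n : nat.

Let coord : 'I_n -> 'rV[R]_n -> R := fun i x => x ord0 i.

Let rV_set0 : g_sigma_preimage coord set0.
Proof. exact: sigma_algebra0. Qed.

Let rV_setC A : g_sigma_preimage coord A -> g_sigma_preimage coord (~` A).
Proof. exact: sigma_algebraC. Qed.

Let rV_bigcup (F : _^nat) : (forall i, g_sigma_preimage coord (F i)) ->
  g_sigma_preimage coord (\bigcup_i (F i)).
Proof. exact: sigma_algebra_bigcup. Qed.

HB.instance Definition _ := @isMeasurable.Build rV_display
  'rV[R]_n (g_sigma_preimage coord) rV_set0 rV_setC rV_bigcup.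

End measurable_rV.

Lemma measurable_coord (R : realType) n (i : 'I_n) :
  measurable_fun setT (fun x : 'rV[R]_n => x ord0 i).
Proof.
move=> _ Y mY; rewrite setTI; apply: sub_sigma_algebra => /=.
rewrite -bigcup_seq/=; exists i => /=; first by rewrite mem_index_enum.
by exists Y => //; rewrite setTI.
Qed.

Lemma measurable_fun_rV d (T : measurableType d) (R : realType) n
    (f : T -> 'rV[R]_n) :
  (forall i, measurable_fun setT (fun x => f x ord0 i)) ->
  measurable_fun setT f.
Proof.
move=> mf; apply: (measurability (\big[setU/set0]_(i < n)
  preimage_set_system setT (fun x : 'rV[R]_n => x ord0 i) measurable)) => //.
move=> _ [B + <-]; rewrite -bigcup_seq/= => -[i _ [A mA <-]].
by rewrite setTI -comp_preimage; exact: mf.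
Qed.

(* Lebesgue measure on R^(n+1) as the image of the product of Lebesgue measure
   on R and the measure on R^n.  Sigma-finiteness is proved here because the
   library's instance for product measures is only inferred for finite ones. *)
Section lebesgue_rV_succ.
Context {R : realType} (n : nat).
Variable mu : {sigma_finite_measure set 'rV[R]_n -> \bar R}.

Definition rV_cons (p : R * 'rV[R]_n) : 'rV[R]_n.+1 :=
  \row_i oapp (p.2 ord0) p.1 (unlift ord0 i).

Lemma measurable_rV_cons : measurable_fun setT rV_cons.
Proof.
apply: measurable_fun_rV => i; rewrite /rV_cons.
under eq_fun do rewrite mxE.
case: unliftP => [j _|_] /=; last exact: measurable_fst.
exact: (measurableT_comp (measurable_coord j)).
Qed.

Definition lebesgue_rV_succ : set 'rV[R]_n.+1 -> \bar R :=
  pushforward (lebesgue_measure \x mu)%E rV_cons.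

Let lebesgue_rV_succ0 : lebesgue_rV_succ set0 = 0%E.
Proof. by rewrite /lebesgue_rV_succ /pushforward preimage_set0 measure0. Qed.

Let lebesgue_rV_succ_ge0 A : (0 <= lebesgue_rV_succ A)%E.
Proof. by rewrite /lebesgue_rV_succ /pushforward measure_ge0. Qed.

Let lebesgue_rV_succ_sigma_additive : semi_sigma_additive lebesgue_rV_succ.
Proof.
move=> F mF tF mUF; rewrite /lebesgue_rV_succ /pushforward preimage_bigcup.
have mp A : measurable A -> measurable (rV_cons @^-1` A).
  by move=> mA; rewrite -[X in measurable X]setTI; exact: measurable_rV_cons.
apply: measure_semi_sigma_additive.
- by move=> k; exact: mp.
- apply/trivIsetP => /= i j _ _ ij; rewrite -preimage_setI.
  by move/trivIsetP : tF => /(_ _ _ _ _ ij) ->//; rewrite preimage_set0.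
- by rewrite -preimage_bigcup; exact: mp.
Qed.

HB.instance Definition _ := isMeasure.Build _ _ _ lebesgue_rV_succ
  lebesgue_rV_succ0 lebesgue_rV_succ_ge0 lebesgue_rV_succ_sigma_additive.

Let sigma_finite_lebesgue_rV_succ : sigma_finite setT lebesgue_rV_succ.
Proof.
pose g (x : 'rV[R]_n.+1) : R * 'rV[R]_n := (x ord0 ord0, \row_j x ord0 (lift ord0 j)).
have gK : cancel rV_cons g.
  move=> [a v]; rewrite /g /rV_cons !mxE unlift_none /=; congr pair.
  by apply/rowP => j; rewrite !mxE liftK.
have mg : measurable_fun setT g.
  apply/measurable_fun_pairP; split; first exact: measurable_coord.
  apply: measurable_fun_rV => i /=.
  by under eq_fun do rewrite mxE; exact: measurable_coord.
have /sigma_finiteP[F [FT ndF Foo]] := sigma_finiteT (@lebesgue_measure R).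
have /sigma_finiteP[G [GT ndG Goo]] := sigma_finiteT mu.
exists (fun k => g @^-1` (F k `*` G k)).
  rewrite -preimage_bigcup [X in g @^-1` X](_ : _ = setT) ?preimage_setT//.
  rewrite -subTset => -[x y] _.
  have [k _ Fkx] : (\bigcup_k F k) x by rewrite -FT.
  have [l _ Gly] : (\bigcup_l G l) y by rewrite -GT.
  exists (maxn k l) => //; split.
  - by move: x Fkx; exact/subsetPset/ndF/leq_maxl.
  - by move: y Gly; exact/subsetPset/ndG/leq_maxr.
move=> k; have [mF Fk] := Foo k; have [mG Gk] := Goo k; split.
  by rewrite -[X in measurable X]setTI; apply: mg => //; exact: measurableX.
rewrite /lebesgue_rV_succ /pushforward -comp_preimage.
rewrite (_ : g \o rV_cons = id); last by rewrite funeqE => x /=; rewrite gK.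
by rewrite preimage_id product_measure1E// lte_mul_pinfty// ge0_fin_numE.
Qed.

HB.instance Definition _ := Measure_isSigmaFinite.Build _ _ _
  lebesgue_rV_succ sigma_finite_lebesgue_rV_succ.

End lebesgue_rV_succ.

Fixpoint lebesgue_rV {R : realType} (d : nat) :
    {sigma_finite_measure set 'rV[R]_d -> \bar R} :=
  match d with
  | 0 => \d_(0 : 'rV[R]_0)
  | n.+1 => lebesgue_rV_succ (lebesgue_rV n)
  end.

Section volume_dimension.
Context {R : realType} {d : nat}.
Implicit Types (x y : 'rV[R]_d) (X : set 'rV[R]_d).

(* The norm the library puts on row vectors is the sup norm. *)
Definition enorm x : R := Num.sqrt (\sum_(i < d) x ord0 i ^+ 2).

Definition eball x (r : R) : set 'rV[R]_d := [set y | enorm (y - x) < r].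

Definition vol_limsup X (P : probability 'rV[R]_d R) (nu : R) : \bar R :=
  limf_esup (fun r : R => ereal_sup
    [set P (eball x r) * (r `^ nu)^-1%:E | x in X])%E 0^'+.

Definition volume_dimension X (P : probability 'rV[R]_d R) : \bar R :=
  ereal_sup [set nu%:E | nu in [set nu | 0 <= nu /\ (vol_limsup X P nu < +oo)%E]].

End volume_dimension.

Section covering_number.
Context {disp : measure_display} {T : measurableType disp} {R : realType}.

Definition L2_coverable (F : set (T -> R)) (Q : probability T R) (eta : R)
    (m : nat) : Prop :=
  exists c : 'I_m -> T -> R, (forall i, F (c i)) /\
    forall f, F f ->
      exists i, (Lnorm Q 2%:E (fun y => (f y - c i y)%:E) < eta%:E)%E.

(* Equal to +oo when there is no finite cover. *)
Definition covering_number (F : set (T -> R)) (Q : probability T R) (eta : R)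
    : \bar R :=
  ereal_inf [set m%:R%:E | m in L2_coverable F Q eta].

End covering_number.

Section kernel.
Context {R : realType} {d : nat}.
Implicit Types (K : 'rV[R]_d -> R) (X : set 'rV[R]_d).

Definition scaled_kernel K (x : 'rV[R]_d) (h : R) : 'rV[R]_d -> R :=
  fun y => K (h^-1 *: (x - y)).

Definition bounded_kernel K : Prop := has_ubound (range (fun x => `|K x|)).

Definition sup_norm K : R := sup (range (fun x => `|K x|)).

Definition tail_sup K (t : R) : R :=
  sup [set `|K x| ^+ 2 | x in [set x | t <= enorm x]].

Definition integrable_tail K (dvol : R) : Prop :=
  bounded_kernel K /\
  (dvol = 0 \/
   (\int[lebesgue_measure]_(t in `]0%R, +oo[) (t `^ (dvol - 1) * tail_sup K t)%:E
     < +oo)%E).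

Definition kernel_class K X (l : R) : set ('rV[R]_d -> R) :=
  [set f | exists x h, [/\ X x, l <= h & f = scaled_kernel K x h]].

Definition VC_kernel K X (l A nu : R) : Prop :=
  [/\ bounded_kernel K,
      (Lnorm (lebesgue_rV d) 2%:E (EFin \o K) < +oo)%E,
      0 < A, 0 < nu &
      forall (Q : probability 'rV[R]_d R) (eta : R), 0 < eta < sup_norm K ->
        (covering_number (kernel_class K X l) Q eta
          <= ((A * sup_norm K / eta) `^ nu)%:E)%E].

Definition second_moment_bound K X (P : probability 'rV[R]_d R)
    (dvol eps C2 : R) : Prop :=
  forall x h, X x -> 0 < h ->
    (\int[P]_y (scaled_kernel K x h y ^+ 2)%:E
      <= (C2 * h `^ (dvol - eps))%:E)%E.

Definition admissible_eps X (P : probability 'rV[R]_d R) (dvol eps : R) : Prop :=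
  0 < eps < dvol \/
  (eps = 0 /\ (dvol = 0 \/ (vol_limsup X P dvol < +oo)%E)).

End kernel.

Section sample.
Context {R : realType} {d : nat} {disp : measure_display}
  {Omega : measurableType disp} {Pr : probability Omega R}.

Definition iid (P : probability 'rV[R]_d R) n
    (xi : 'I_n -> {RV Pr >-> 'rV[R]_d}) : Prop :=
  (forall i B, measurable B -> distribution Pr (xi i) B = P B) /\
  (forall (J : {set 'I_n}) (B : 'I_n -> set 'rV[R]_d),
    (forall i, measurable (B i)) ->
    Pr (\bigcap_(i in [set` J]) (xi i @^-1` B i)) =
    (\prod_(i in J) Pr (xi i @^-1` B i))%E).

Definition kde K n (xi : 'I_n -> {RV Pr >-> 'rV[R]_d}) (h : R) (x : 'rV[R]_d)
    (w : Omega) : R :=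
  (n%:R * h ^+ d)^-1 * \sum_(i < n) scaled_kernel K x h (xi i w).

Definition mean_kde K n (xi : 'I_n -> {RV Pr >-> 'rV[R]_d}) (h : R)
    (x : 'rV[R]_d) : R :=
  fine 'E_Pr[kde K xi h x].

Definition kde_sup_deviation K X (l : R) n (xi : 'I_n -> {RV Pr >-> 'rV[R]_d})
    (w : Omega) : \bar R :=
  ereal_sup [set `|kde K xi p.2 p.1 w - mean_kde K xi p.2 p.1|%:E |
    p in [set p : 'rV[R]_d * R | X p.1 /\ l <= p.2]].

(* The sup over an uncountable family need not be a measurable function, so
   probability at least p means that the event contains a measurable event of
   probability at least p. *)
Definition with_probability_at_least (p : R) (S : set Omega) : Prop :=
  exists E, [/\ measurable E, E `<=` S & (p%:E <= Pr E)%E].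

End sample.

Definition kde_rate {R : realType} (d : nat) (dvol eps : R) (n : nat) (l delta : R)
    : R :=
  let logl := Num.max (ln l^-1) 0 in
  let N1 := n%:R * l ^+ d in
  let N2 := n%:R * l `^ (2 * d%:R - dvol + eps) in
  logl / N1 + Num.sqrt (logl / N2) + Num.sqrt (ln (2 / delta) / N2)
    + ln (2 / delta) / N1.

(* Main.v *)
(* Multiplying K_{x,h} by (l/h)^d turns p-hat_h - p_h into l^-d times an empirical mean minus
   its expectation, over a class uniformly bounded by sup|K| with second moments O(l^(dvol-eps)):
   the growth P(B(x,r)) <= c r^(dvol-eps) is summed over dyadic annuli, and the damping absorbs
   h > l because 2d - dvol + eps >= 0. A ghost sample replaces the expectation by a second
   empirical mean; exchanging the two halves coordinatewise preserves the law of the double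
   sample, so given the 2n points only random signs remain. If the two empirical second moments
   are unbalanced, Hoeffding's inequality on one net applies; otherwise dyadic chaining does. The
   nets come from the VC bound at the empirical measure of the 2n points, and chaining from scale
   l^((dvol-eps)/2) downwards costs log(1/l) but no log n. The supremum over the uncountable class
   is harmless because projections of measurable subsets of Omega x R^(d+1) are, up to null sets,
   measurable (Suslin schemes and a capacity argument). *)

(* The obstacle is a Bernstein-type rate, with variance [sigma ^+ 2] and range [U], obtained from
   Hoeffding's inequality alone. The level [S = 64 * sigma ^+ 2 + 64 * U ^+ 2 * L / n] replaces the
   variance: its first part yields the square-root terms of the rate, its second the terms in
   [1 / (n * l ^+ d)].

   All logarithms sit in [L = 3 * ln M + ln (24 / delta)]. The net at depth [k] has at most
   [M ^+ k.+1] points, so consecutive nets have at most [(M ^+ 3) ^+ k.+1] links, and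
   [M ^+ 3 * expR (- L) = delta / 24] turns the union over all depths into a geometric series. [M]
   depends on [A], [nu] and an upper bound [r] for [U / sigma], never on [n].

   Taking [sigma ^+ 2] to be the maximum of [C2] and [U ^+ 2], times [l] to the power [dvol - eps],
   keeps [U / sigma] below the exponential of [(dvol - eps) / 2] times the positive part of
   [ln l^-1]. Hence [ln M] is affine in that positive part.

   The budget: the signs fail with frequency [6 * (delta / 24) = delta / 4], the projection theorem
   needs room and raises this to [delta / 2], and removing the ghost sample doubles it. *)
Require Import Defs.
From HB Require Import structures.
From mathcomp Require Import all_boot all_order all_algebra.
From mathcomp Require Import all_classical all_reals all_analysis.
From mathcomp Require Import measurable_realfun ring lra.
Set Implicit Arguments.
Unset Strict Implicit.
Unset Printing Implicit Defensive.
Import Order.TTheory GRing.Theory Num.Theory.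
Import numFieldNormedType.Exports.
Local Open Scope classical_set_scope.
Local Open Scope ring_scope.

(** * Random signs *)

Section rademacher.
Context {R : realType} {n : nat}.
Implicit Types (S : set {ffun 'I_n -> bool}) (s : {ffun 'I_n -> bool}) (a : 'I_n -> R).

(** The uniform probability on sign vectors, as a finite average. *)
Definition sign_frac S : R := (2 ^+ n)^-1 * \sum_s \1_S s.

Lemma le_sign_frac S S' : S `<=` S' -> sign_frac S <= sign_frac S'.
Proof.
move=> SS'; apply: ler_wpM2l; first by rewrite invr_ge0 exprn_ge0.
apply: ler_sum => s _; rewrite !indicE ler_nat.
by case: (boolP (s \in S)) => // /set_mem/SS'/mem_set ->.
Qed.

Lemma sign_fracU S S' : sign_frac (S `|` S') <= sign_frac S + sign_frac S'.
Proof.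
rewrite -mulrDr; apply: ler_wpM2l; first by rewrite invr_ge0 exprn_ge0.
rewrite -big_split; apply: ler_sum => s _ /=; rewrite !indicE -natrD ler_nat in_setU.
by case: (s \in S); case: (s \in S').
Qed.

Lemma sign_frac0 : sign_frac set0 = 0.
Proof. by rewrite /sign_frac big1 ?mulr0// => s _; rewrite indic0. Qed.

Lemma sign_frac_bigcup (I : finType) (F : I -> set {ffun 'I_n -> bool}) (e : R) :
  (forall i, sign_frac (F i) <= e) ->
  sign_frac [set s | exists i, F i s] <= #|I|%:R * e.
Proof.
move=> Fe; apply: (@le_trans _ _ (\sum_i sign_frac (F i))); last first.
  by rewrite mulr_natl -sumr_const; exact: ler_sum.
rewrite -mulr_sumr; apply: ler_wpM2l; first by rewrite invr_ge0 exprn_ge0.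
rewrite exchange_big; apply: ler_sum => s _ /=.
rewrite [leLHS]indicE; case: (boolP (s \in _)) => [/set_mem[i Fis]|_].
  rewrite (bigD1 i)//= [\1_(F i) s]indicE mem_set// lerDl.
  by apply: sumr_ge0 => j _; rewrite indicE.
by apply: sumr_ge0 => j _; rewrite indicE.
Qed.

Definition sign_sum s a : R := \sum_i (-1) ^+ s i * a i.

(** A crude form of [cosh x <= exp (x^2 / 2)], whose weaker constant permits an elementary proof.
    For [x >= 1/2] one has [x <= 2 * x ^+ 2]; below, [expR y <= (1 - y)^-1] reduces the claim to a
    rational inequality. *)
Lemma expR_sqr_ge (x : R) : expR x + expR (- x) <= 2 * expR (2 * x ^+ 2).
Proof.
wlog x0 : x / 0 <= x.
  move=> H; have [/H//|x0] := leP 0 x.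
  by rewrite addrC -{2}(opprK x) -sqrrN H// oppr_ge0 ltW.
have [x1|x1] := leP (1 / 2) x.
  have h : x <= 2 * x ^+ 2 by nra.
  have : expR x <= expR (2 * x ^+ 2) by rewrite ler_expR.
  have : expR (- x) <= expR (2 * x ^+ 2) by rewrite ler_expR; lra.
  by lra.
have inv (y : R) : y < 1 -> expR y <= (1 - y)^-1.
  move=> y1; rewrite -[y in expR y]opprK expRN lef_pV2 ?posrE ?expR_gt0 ?subr_gt0//.
  exact: expR_ge1Dx.
have e1 := inv x ltac:(lra); have e2 := inv (- x) ltac:(lra).
have e3 : (1 - x)^-1 + (1 - - x)^-1 = 2 * (1 - x ^+ 2)^-1.
  by field; apply/andP; split; [|apply/andP; split]; nra.
have e4 : (1 - x ^+ 2)^-1 <= expR (2 * x ^+ 2).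
  have q0 : 0 < 1 - x ^+ 2 by nra.
  rewrite -div1r ler_pdivrMr//.
  apply: (@le_trans _ _ ((1 + 2 * x ^+ 2) * (1 - x ^+ 2))).
    have : x ^+ 2 <= 1 / 4 by nra.
    by have := sqr_ge0 x; move: (x ^+ 2) => y; nra.
  by rewrite ler_pM2r//; exact: expR_ge1Dx.
by lra.
Qed.

Lemma sign_mgf (a : 'I_n -> R) (V : R) : \sum_i a i ^+ 2 <= V ->
  (2 ^+ n)^-1 * \sum_s expR (sign_sum s a) <= expR (2 * V).
Proof.
move=> aV.
have -> : \sum_s expR (sign_sum s a) = \prod_i (expR (a i) + expR (- a i)).
  have -> : \prod_i (expR (a i) + expR (- a i)) =
            \prod_i \sum_(b : bool) expR ((-1) ^+ b * a i).
    by apply: eq_bigr => i _; rewrite big_bool /= expr1 expr0 mulN1r mul1r addrC.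
  rewrite bigA_distr_bigA/=; apply: eq_bigr => s _.
  by rewrite /sign_sum expR_sum.
apply: (@le_trans _ _ ((2 ^+ n)^-1 * \prod_i (2 * expR (2 * a i ^+ 2)))).
  apply: ler_wpM2l; first by rewrite invr_ge0 exprn_ge0.
  apply: ler_prod => i _; rewrite expR_sqr_ge andbT.
  by rewrite addr_ge0 ?expR_ge0.
rewrite big_split/= prodr_const card_ord mulrA mulVf ?mul1r ?expf_neq0//.
by rewrite -expR_sum ler_expR -mulr_sumr ler_pM2l.
Qed.

Lemma hoeffding_sign (a : 'I_n -> R) (V t : R) : \sum_i a i ^+ 2 <= V ->
  0 < V -> 0 <= t ->
  sign_frac [set s | t <= `|sign_sum s a|] <= 2 * expR (- (t ^+ 2 / (8 * V))).
Proof.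
(* Chernoff's method: this [l] minimizes the exponent [2 * l ^+ 2 * V - l * t], with minimum
   [- t ^+ 2 / (8 * V)]. *)
move=> aV V0 t0; pose l := t / (4 * V).
have l0 : 0 <= l by rewrite divr_ge0// mulr_ge0// ltW.
have half (b : bool) :
    sign_frac [set s | t <= (-1) ^+ b * sign_sum s a] <= expR (- (t ^+ 2 / (8 * V))).
  have := @sign_mgf (fun i => l * (-1) ^+ b * a i) (l ^+ 2 * V).
  have -> : \sum_i (l * (-1) ^+ b * a i) ^+ 2 = l ^+ 2 * \sum_i a i ^+ 2.
    rewrite mulr_sumr; apply: eq_bigr => i _.
    by rewrite !exprMn sqrr_sign mulr1.
  move=> /(_ (ler_wpM2l (sqr_ge0 _) aV)) H.
  have -> : - (t ^+ 2 / (8 * V)) = 2 * (l ^+ 2 * V) + (- (l * t)).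
    by rewrite /l; field; rewrite gt_eqF.
  rewrite expRD; apply: le_trans; last by apply: ler_wpM2r H; exact: expR_ge0.
  rewrite /sign_frac -mulrA; apply: ler_wpM2l; first by rewrite invr_ge0 exprn_ge0.
  rewrite mulr_suml; apply: ler_sum => s _; rewrite indicE -expRD.
  case: (boolP (s \in _)) => [/set_mem/= ts|_]; last exact: expR_ge0.
  apply: (@le_trans _ _ (expR 0)); first by rewrite expR0.
  rewrite ler_expR.
  have -> : sign_sum s (fun i => l * (-1) ^+ b * a i) = l * ((-1) ^+ b * sign_sum s a).
    rewrite /sign_sum !mulr_sumr; apply: eq_bigr => i _; ring.
  by rewrite -mulrN -mulrDr mulr_ge0// subr_ge0.
apply: (@le_trans _ _ (sign_frac ([set s | t <= (-1) ^+ false * sign_sum s a] `|`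
    [set s | t <= (-1) ^+ true * sign_sum s a]))).
  apply: le_sign_frac => s /=; rewrite expr0 expr1 mul1r mulN1r.
  by rewrite ler_normr => /orP[]; [left|right].
apply: le_trans (sign_fracU _ _) _.
by have := half false; have := half true; lra.
Qed.

End rademacher.

(** * Chaining over random swaps of a double sample *)

Section double_sample.
Context {R : realType} {n : nat}.
Implicit Types (v w : bool * 'I_n -> R) (s : {ffun 'I_n -> bool}).

Definition swap (V : Type) (s : {ffun 'I_n -> bool}) (v : bool * 'I_n -> V) :=
  fun p : bool * 'I_n => v (p.1 (+) s p.2, p.2).

Definition avg (b : bool) v : R := n%:R^-1 * \sum_i v (b, i).

Definition avg_sqr b v : R := avg b (fun p => v p ^+ 2).

Definition tot_sqr v : R := avg_sqr false v + avg_sqr true v.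

Lemma le_avg b v w : (forall p, v p <= w p) -> avg b v <= avg b w.
Proof. by move=> vw; apply: ler_wpM2l => //; exact: ler_sum. Qed.

Lemma avgD b v w : avg b (fun p => v p + w p) = avg b v + avg b w.
Proof. by rewrite /avg big_split mulrDr. Qed.

Lemma avgZ b c v : avg b (fun p => c * v p) = c * avg b v.
Proof. by rewrite /avg -mulr_sumr mulrCA. Qed.

Lemma avg_sqr_ge0 b v : 0 <= avg_sqr b v.
Proof. by rewrite mulr_ge0// sumr_ge0// => i _; exact: sqr_ge0. Qed.

Lemma avg_sqr_le_tot b v : avg_sqr b v <= tot_sqr v.
Proof.
by rewrite /tot_sqr; case: b; rewrite ?lerDl ?lerDr; exact: avg_sqr_ge0.
Qed.

(** Thanks to this invariance one net, built before any swap, serves all sign vectors at once. *)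
Lemma tot_sqr_swap s v : tot_sqr (swap s v) = tot_sqr v.
Proof.
rewrite /tot_sqr /avg_sqr /avg -!mulrDr -!big_split/=; congr *%R.
by apply: eq_bigr => i _; rewrite /swap /=; case: (s i); rewrite //= addrC.
Qed.

(** Young's inequality with unequal weights: the coefficient of [w] stays close to 1, so that a net
    point near a vector of second moment [S] keeps more than half of it. *)
Lemma avg_sqr_le_dist b v w :
  avg_sqr b v <= 5 / 4 * avg_sqr b w + 5 * avg_sqr b (fun p => v p - w p).
Proof.
rewrite -!avgZ -avgD; apply: le_avg => p.
by have := sqr_ge0 (v p - 5 * (v p - w p)); rewrite !expr2; nra.
Qed.

Lemma avg_sqr_le_dist2 b v w :
  avg_sqr b w <= 2 * (avg_sqr b v + avg_sqr b (fun p => v p - w p)).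
Proof.
rewrite -avgD -avgZ; apply: le_avg => p.
by have := sqr_ge0 (v p + (v p - w p)); rewrite !expr2; nra.
Qed.

Lemma avg_sqr_le2 b v w : avg_sqr b (fun p => v p + w p) <= 2 * (avg_sqr b v + avg_sqr b w).
Proof.
rewrite -avgD -avgZ; apply: le_avg => p.
by have := sqr_ge0 (v p - w p); rewrite !expr2; nra.
Qed.

Lemma tot_sqr_le2 v w : tot_sqr (fun p => v p + w p) <= 2 * (tot_sqr v + tot_sqr w).
Proof. by have := avg_sqr_le2 false v w; have := avg_sqr_le2 true v w; rewrite /tot_sqr; lra. Qed.

Lemma tot_sqrN v : tot_sqr (fun p => - v p) = tot_sqr v.
Proof.
by rewrite /tot_sqr /avg_sqr /avg; congr (_ * _ + _ * _); apply: eq_bigr => i _; rewrite sqrrN.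
Qed.

Definition swap_diff s v := avg false (swap s v) - avg true (swap s v).

Lemma swap_diffE s v :
  swap_diff s v = n%:R^-1 * sign_sum s (fun i => v (false, i) - v (true, i)).
Proof.
rewrite /swap_diff /avg -mulrBr -sumrB; congr *%R; apply: eq_bigr => i _.
by rewrite /swap/=; case: (s i) => /=; rewrite ?expr1 ?expr0; ring.
Qed.

Lemma swap_diffD s v w : swap_diff s (fun p => v p + w p) = swap_diff s v + swap_diff s w.
Proof.
by rewrite /swap_diff !(avgD _ (swap s v) (swap s w)); ring.
Qed.

Lemma tot_sqrE v : (0 < n)%N -> n%:R * tot_sqr v = \sum_i (v (false, i) ^+ 2 + v (true, i) ^+ 2).
Proof.
move=> n0; rewrite /tot_sqr /avg_sqr /avg -mulrDr mulrA divff ?mul1r ?big_split//.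
by rewrite pnatr_eq0 -lt0n.
Qed.

Lemma sum_diff_sqr_le v : (0 < n)%N ->
  \sum_i (v (false, i) - v (true, i)) ^+ 2 <= 2 * n%:R * tot_sqr v.
Proof.
move=> n0; rewrite -mulrA tot_sqrE// mulr_sumr; apply: ler_sum => i _.
by have := sqr_ge0 (v (false, i) + v (true, i)); rewrite !expr2; nra.
Qed.

(** Cauchy-Schwarz. The bound holds for every sign vector, which allows the chain to be cut at a
    finite depth. *)
Lemma swap_diff_sqr_le s v : (0 < n)%N -> swap_diff s v ^+ 2 <= 2 * tot_sqr v.
Proof.
move=> n0; have nR : 0 < n%:R :> R by rewrite ltr0n.
pose a i := v (false, i) - v (true, i).
rewrite swap_diffE exprMn exprVn ler_pdivrMl ?exprn_gt0//.
have CS : sign_sum s a ^+ 2 <= n%:R * \sum_i a i ^+ 2.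
  have -> : sign_sum s a ^+ 2 =
      \sum_i \sum_j ((-1) ^+ s i * a i) * ((-1) ^+ s j * a j).
    rewrite expr2 /sign_sum mulr_suml; apply: eq_bigr => i _.
    by rewrite mulr_sumr.
  have -> : n%:R * \sum_i a i ^+ 2 = \sum_i \sum_j (a i ^+ 2 + a j ^+ 2) / 2.
    under [RHS]eq_bigr do rewrite -mulr_suml big_split/= sumr_const card_ord.
    rewrite -mulr_suml big_split/= sumr_const card_ord.
    under [X in _ = (X + _) / _]eq_bigr do rewrite -mulr_natl.
    by rewrite -mulr_sumr -mulr_natl; field.
  apply: ler_sum => i _; apply: ler_sum => j _.
  have -> : a i ^+ 2 = ((-1) ^+ s i * a i) ^+ 2 by rewrite exprMn sqrr_sign mul1r.
  have -> : a j ^+ 2 = ((-1) ^+ s j * a j) ^+ 2 by rewrite exprMn sqrr_sign mul1r.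
  move: ((-1) ^+ s i * a i) ((-1) ^+ s j * a j) => e f.
  by have := sqr_ge0 (e - f); rewrite !expr2; lra.
apply: le_trans CS _; rewrite expr2 -!mulrA ler_pM2l//.
by have := sum_diff_sqr_le v n0; rewrite -/(a _); lra.
Qed.

Variables (V : set (bool * 'I_n -> R)) (U sigma M : R).
Hypotheses (n0 : (0 < n)%N) (U0 : 0 < U) (sigma0 : 0 < sigma) (M1 : 1 <= M).
Hypothesis net : forall k, exists m (c : 'I_m -> bool * 'I_n -> R),
  [/\ m%:R <= M ^+ k.+1, (forall j p, `|c j p| <= U) &
    forall v, V v -> exists j, tot_sqr (fun p => v p - c j p) <= 2 * sigma ^+ 2 / 4 ^+ k].

Variables L S theta : R.
Hypotheses (L0 : 0 < L) (S64 : 64 * sigma ^+ 2 <= S)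
  (SU : 64 * U ^+ 2 * L <= n%:R * S)
  (theta0 : 0 < theta) (thetaS : 320 * S * L <= n%:R * theta ^+ 2).

Let nR : 0 < n%:R :> R. Proof. by rewrite ltr0n. Qed.

Let S0 : 0 < S.
Proof. by have := exprn_gt0 2 sigma0; move: S64; lra. Qed.

(* One net suffices here: a large empirical second moment on one half only is a deviation
   of the order of the total second moment, to which Hoeffding's variance is proportional. *)
Lemma unbalanced_sqr : sign_frac [set s | exists2 v, V v &
    S < avg_sqr false (swap s v) /\ avg_sqr true (swap s v) <= 4 * sigma ^+ 2] <=
  2 * (M * expR (- L)).
Proof.
have [m [c [mM cU cV]]] := net 0%N.
(* The condition [S < 2 * tot_sqr (c j)] belongs to the event because Hoeffding's exponent will be
   proportional to [tot_sqr (c j)] and must reach [L]. *)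
pose F (j : 'I_m) s := S < 2 * tot_sqr (c j) /\
  n%:R * tot_sqr (c j) / 2 <= `|sign_sum s (fun i => c j (false, i) ^+ 2 - c j (true, i) ^+ 2)|.
have FE : (forall j, sign_frac (F j) <= 2 * expR (- L)).
  move=> j; have [Sc|Sc] := ltP S (2 * tot_sqr (c j)); last first.
    rewrite (_ : F j = set0) ?sign_frac0 ?mulr_ge0 ?expR_ge0//.
    by rewrite -subset0 => s [/=]; rewrite ltNge Sc.
  have tc0 : 0 < tot_sqr (c j) by move: S0; lra.
  apply: (@le_trans _ _ (sign_frac [set s | n%:R * tot_sqr (c j) / 2 <=
      `|sign_sum s (fun i => c j (false, i) ^+ 2 - c j (true, i) ^+ 2)|])).
    by apply: le_sign_frac => s [].
  (* For entries bounded by [U], the squared difference of two squares is at most [U ^+ 2] times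
     their sum, so the variance proxy is linear in [tot_sqr (c j)]. The exponent becomes
     [n * tot_sqr (c j) / (32 * U ^+ 2)], whence the factor 64 in [SU]. *)
  apply: le_trans (@hoeffding_sign _ _ _ (U ^+ 2 * (n%:R * tot_sqr (c j))) _ _ _ _) _.
  - rewrite tot_sqrE// mulr_sumr; apply: ler_sum => i _.
    have sqU p : c j p ^+ 2 <= U ^+ 2.
      by rewrite -(@real_normK _ (c j p)) ?num_real// ler_pXn2r ?nnegrE ?(ltW U0).
    have := sqU (false, i); have := sqU (true, i).
    move: (sqr_ge0 (c j (false, i))) (sqr_ge0 (c j (true, i))).
    move: (c j (false, i) ^+ 2) (c j (true, i) ^+ 2) (U ^+ 2) => a b u a0 b0 bu au.
    have : a * a <= u * a by rewrite ler_wpM2r.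
    have : b * b <= u * b by rewrite ler_wpM2r.
    by have := mulr_ge0 a0 b0; rewrite expr2; nra.
  - by rewrite !mulr_gt0 ?exprn_gt0.
  - by rewrite !mulr_ge0 ?invr_ge0// ltW.
  rewrite ler_pM2l// ler_expR lerN2.
  have -> : (n%:R * tot_sqr (c j) / 2) ^+ 2 / (8 * (U ^+ 2 * (n%:R * tot_sqr (c j)))) =
    n%:R * tot_sqr (c j) / (32 * U ^+ 2).
    by field; rewrite !gt_eqF.
  rewrite ler_pdivlMr ?mulr_gt0 ?exprn_gt0//.
  have : n%:R * S <= n%:R * (2 * tot_sqr (c j)) by rewrite ler_pM2l// ltW.
  by move: SU; lra.
apply: (@le_trans _ _ (sign_frac [set s | exists j, F j s])); last first.
  apply: le_trans (sign_frac_bigcup FE) _; rewrite card_ord mulrCA ler_pM2l//.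
  by rewrite ler_wpM2r ?expR_ge0// -[M]expr1.
apply: le_sign_frac => s [v Vv [v1 v2]]; have [j cvj] := cV v Vv.
exists j; set w := swap s (c j).
have dE : tot_sqr (fun p => swap s v p - w p) <= 2 * sigma ^+ 2.
  have -> : (fun p => swap s v p - w p) = swap s (fun p => v p - c j p) by [].
  by rewrite tot_sqr_swap; rewrite expr0 divr1 in cvj.
have h1 := avg_sqr_le_tot false (fun p => swap s v p - w p).
have h2 := avg_sqr_le_tot true (fun p => swap s v p - w p).
(* Here the factor 64 of [S64] is spent: the false half of [w] exceeds
   [4 / 5 * (S - 10 * sigma ^+ 2)], thus [43 * sigma ^+ 2], and its true half is at most
   [12 * sigma ^+ 2]; their gap is then at least half the total. *)
have h3 := avg_sqr_le_dist false (swap s v) w.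
have h4 : avg_sqr true w <= 2 * (avg_sqr true (swap s v) + avg_sqr true (fun p => swap s v p - w p)).
  exact: avg_sqr_le_dist2.
have wE : tot_sqr w = tot_sqr (c j) by rewrite tot_sqr_swap.
have h5 : tot_sqr w = avg_sqr false w + avg_sqr true w by [].
have -> : F j s = (S < 2 * tot_sqr w /\
    n%:R * tot_sqr w / 2 <= `|n%:R * (avg_sqr false w - avg_sqr true w)|).
  rewrite /F wE; congr (_ /\ _ <= `|_|).
  have := swap_diffE s (fun p => c j p ^+ 2).
  rewrite /swap_diff -/(avg_sqr false w) -/(avg_sqr true w) => ->.
  by rewrite mulrA divff ?mul1r ?gt_eqF.
have S0' := S0; have h6 := avg_sqr_ge0 true w; clearbody w.
move: v1 v2 h1 h2 h3 h4 dE h5 h6 S64 S0'.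
move: (avg_sqr false (fun p => _)) (avg_sqr true (fun p => _)) (tot_sqr (fun p => _)).
move: (tot_sqr w) (avg_sqr false w) (avg_sqr true w) (sigma ^+ 2).
move: (avg_sqr false (swap s v)) (avg_sqr true (swap s v)).
move=> a1 a2 a3 a4 a5 a6 a7 a8 a9 v1 v2 h1 h2 h3 h4 dE h5 h6 S64' S0'.
split; first by lra.
by apply: le_trans (ler_norm _); rewrite -mulrA ler_pM2l//; lra.
Qed.

(** The factor [k.+1] beside the geometric decay pays for the growth of the nets: Hoeffding's
    exponent gains its square, while the thresholds stay summable. *)
Definition chain_bound (k : nat) : R := theta * (k.+1%:R / 2 ^+ k.+1).

Lemma sum_chain_bound K : \sum_(k < K) chain_bound k <= 2 * theta.
Proof.
have E : \sum_(k < K) chain_bound k = theta * (2 - K.+2%:R / 2 ^+ K).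
  elim: K => [|K IH]; first by rewrite big_ord0 expr0 divr1 subrr mulr0.
  rewrite big_ord_recr/= IH /chain_bound -!natr1 exprS.
  by field; rewrite expf_neq0.
rewrite E mulrC ler_pM2r// gerBl divr_ge0// exprn_ge0.
Qed.

(** Origin of 320: 8 from Hoeffding, 2 from differencing the two halves, and 20 because a link joins
    points within [2 * S / 4 ^+ k] and [2 * S / 4 ^+ k.+1] of a common vector. *)
Lemma chain_link k (w : bool * 'I_n -> R) :
  tot_sqr w <= 20 * S / 4 ^+ k.+1 ->
  sign_frac [set s | chain_bound k <= `|swap_diff s w|] <= 2 * expR (- L) ^+ k.+1.
Proof.
move=> wS; have S0' := S0; have f0 : 0 < 4 ^+ k.+1 :> R by rewrite exprn_gt0.
have k0 : 0 < k.+1%:R :> R by rewrite ltr0n.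
pose W : R := 40 * n%:R * S / 4 ^+ k.+1.
have W0 : 0 < W by rewrite divr_gt0// !mulr_gt0// ltr0n.
apply: (@le_trans _ _ (sign_frac [set s | n%:R * chain_bound k <=
    `|sign_sum s (fun i => w (false, i) - w (true, i))|])).
  apply: le_sign_frac => s /=; rewrite swap_diffE normrM normfV (gtr0_norm nR).
  by rewrite ler_pdivlMl.
apply: le_trans (@hoeffding_sign _ _ _ W _ _ W0 _) _.
- apply: le_trans (sum_diff_sqr_le _ n0) _.
  have : n%:R * tot_sqr w <= n%:R * (20 * S / 4 ^+ k.+1) by rewrite ler_pM2l.
  by rewrite /W !mulrA; lra.
- by rewrite mulr_ge0 ?mulr_ge0 ?divr_ge0 ?exprn_ge0 ?(ltW theta0).
rewrite ler_pM2l// -expRM_natl ler_expR mulrN lerN2 ler_pdivlMr; last by rewrite mulr_gt0.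
have -> : (n%:R * chain_bound k) ^+ 2 = n%:R * (n%:R * theta ^+ 2) * (k.+1%:R ^+ 2 / 4 ^+ k.+1).
  rewrite /chain_bound; have -> : 4 ^+ k.+1 = (2 ^+ k.+1) ^+ 2 :> R.
    by rewrite -!natrX -expnM mulnC expnM.
  by field; rewrite expf_neq0.
have -> : k.+1%:R * L * (8 * W) = n%:R * (320 * S * L) * (k.+1%:R / 4 ^+ k.+1).
  by rewrite /W; field; rewrite gt_eqF.
have q0 : 0 <= 320 * S * L by rewrite -mulrA; have := mulr_gt0 S0 L0; lra.
move: (320 * S * L) q0 thetaS => q q0 qt.
apply: ler_pM.
- by rewrite mulr_ge0// ltW.
- by rewrite mulr_ge0// invr_ge0 ltW.
- by rewrite ler_pM2l.
- by rewrite ler_pM2r ?invr_gt0// ler_eXnr// ler1n.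
Qed.

Lemma balanced_chaining : M ^+ 3 * expR (- L) <= 1 / 2 ->
  sign_frac [set s | exists2 v, V v &
    tot_sqr v <= 2 * S /\ 5 / 2 * theta < `|swap_diff s v|] <=
  4 * (M ^+ 3 * expR (- L)).
Proof.
have SS : 2 * sigma ^+ 2 <= 2 * S by have := sqr_ge0 sigma; move: S64; lra.
set y := M ^+ 3 * _ => y2.
have y0 : 0 <= y by rewrite mulr_ge0 ?expR_ge0// exprn_ge0// (le_trans _ M1).
(* At depth [K] Cauchy-Schwarz bounds the remainder by [theta / 2]. However large [K] is, it costs
   nothing, since the failure frequencies are summed geometrically. *)
have [K KS] : exists K, 2 * (2 * S / 4 ^+ K) <= (theta / 2) ^+ 2.
  exists (Num.trunc (16 * S / theta ^+ 2)).+1.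
  have t2 : 0 < theta ^+ 2 by rewrite exprn_gt0.
  have := truncnS_gt (16 * S / theta ^+ 2).
  move: (Num.trunc _).+1 => K; rewrite ltr_pdivrMr// => KS.
  have K4 : K%:R <= 4 ^+ K :> R by rewrite -natrX ler_nat ltnW// ltn_expl.
  rewrite mulrA ler_pdivrMr ?exprn_gt0// expr_div_n.
  have : K%:R * theta ^+ 2 <= 4 ^+ K * theta ^+ 2 by rewrite ler_pM2r.
  have -> : 2 ^+ 2 = 4 :> R by ring.
  by lra.
have aux (f g z w : R) : f <= 4 * y - 4 * z -> g <= 2 * z -> w <= 1 / 2 * z ->
  f + g <= 4 * y - 4 * w by lra.
have aux2 (f g x : R) : f <= 2 * S / x -> g <= 2 * S / (4 * x) ->
    2 * (f + g) <= 20 * S / (4 * x).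
  by rewrite !invfM; lra.
have aux3 (f g h : R) : f <= theta / 2 -> g <= 2 * theta -> h <= g + f ->
    5 / 2 * theta < h -> False.
  by lra.
pose m' k := projT1 (cid (net k)).
pose c' k : 'I_(m' k) -> bool * 'I_n -> R := projT1 (cid (projT2 (cid (net k)))).
have cP k := projT2 (cid (projT2 (cid (net k)))).
(* Depth 0 has the single centre 0, which lies within [2 * S] of every balanced vector; the chain
   thus starts at the radius given by [S], not by [U]. *)
pose m k := if k is j.+1 then m' k else 1%N.
pose c k : 'I_(m k) -> bool * 'I_n -> R :=
  match k with 0 => fun _ _ => 0 | j.+1 => c' j.+1 end.
have mM k : (m k)%:R <= M ^+ k.+1.
  by case: k => [|k] /=; [rewrite expr1|case: (cP k.+1)].
have cV k v : V v -> tot_sqr v <= 2 * S ->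
    exists j, tot_sqr (fun p => v p - c k j p) <= 2 * S / 4 ^+ k.
  case: k => [|k] Vv vS; first by exists ord0; under eq_fun do rewrite subr0; rewrite expr0 divr1.
  have [_ _ /(_ v Vv)[j jk]] := cP k.+1; exists j; apply: (le_trans jk).
  apply: ler_wpM2r; first by rewrite invr_ge0 exprn_ge0.
  exact: SS.
pose F (k : 'I_K) (ij : 'I_(m k) * 'I_(m k.+1)) s :=
  tot_sqr (fun p => c k.+1 ij.2 p - c k ij.1 p) <= 20 * S / 4 ^+ k.+1 /\
  chain_bound k <= `|swap_diff s (fun p => c k.+1 ij.2 p - c k ij.1 p)|.
pose G (k : 'I_K) := [set s | exists ij, @F k ij s].
have GE (k : 'I_K) : sign_frac (G k) <= 2 * y ^+ k.+1.
  apply: le_trans (@sign_frac_bigcup _ _ _ _ (2 * expR (- L) ^+ k.+1) _) _.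
    move=> ij; have [Fij|nF] := leP (tot_sqr (fun p => c k.+1 ij.2 p - c k ij.1 p)) (20 * S / 4 ^+ k.+1).
      by apply: le_trans (chain_link Fij); apply: le_sign_frac => s [].
    rewrite (_ : F k ij = set0) ?sign_frac0 ?mulr_ge0 ?exprn_ge0 ?expR_ge0//.
    by rewrite -subset0 => s [/=]; rewrite leNgt nF.
  rewrite card_prod !card_ord natrM mulrCA ler_pM2l// exprMn -exprM.
  rewrite ler_wpM2r ?exprn_ge0 ?expR_ge0//.
  (* Counting links gives the exponent [2 * k + 3 <= 3 * k.+1], which is where [M ^+ 3] comes
     from. *)
  apply: (@le_trans _ _ (M ^+ k.+1 * M ^+ k.+2)); first exact: ler_pM.
  by rewrite -exprD ler_weXn2l// (mulSn 2) leq_add2l (mulSn 1) mul1n addSn ltnS leq_addl.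
(* The subtracted term makes the induction close: the new summand is [2 * y ^+ J.+1], and
   [y <= 1 / 2]. *)
have UG J : (J <= K)%N -> sign_frac [set s | exists k : 'I_K, (k < J)%N /\ G k s] <= 4 * y - 4 * y ^+ J.+1.
  elim: J => [_|J IH JK].
    rewrite (_ : [set _ | _] = set0) ?sign_frac0 ?expr1 ?subrr//.
    by rewrite -subset0 => s [k []].
  apply: (@le_trans _ _ (sign_frac ([set s | exists k : 'I_K, (k < J)%N /\ G k s] `|` G (Ordinal JK)))).
    apply: le_sign_frac => s [k []]; rewrite ltnS leq_eqVlt => /orP[/eqP kJ|kJ] Gs.
      by right; rewrite (_ : Ordinal JK = k)//; exact: val_inj.
    by left; exists k.
  apply: le_trans (sign_fracU _ _) _.
  apply: (aux _ _ _ _ (IH (ltnW JK)) (GE (Ordinal JK))).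
  by rewrite /= (exprS _ J.+1) ler_wpM2r ?exprn_ge0.
apply: (@le_trans _ _ (sign_frac [set s | exists k : 'I_K, (k < K)%N /\ G k s])); last first.
  by apply: le_trans (UG K _) _ => //; rewrite gerBl mulr_ge0 ?exprn_ge0.
apply: le_sign_frac => s [v Vv [vS vth]]; apply: contrapT => /forallNP nG.
pose j k := projT1 (cid (cV k v Vv vS)); have jP k := projT2 (cid (cV k v Vv vS)).
pose p k := c k (j k).
have link (k : 'I_K) : `|swap_diff s (fun q => p k.+1 q - p k q)| <= chain_bound k.
  rewrite leNgt; apply/negP => lt; apply: (nG k); split=> //.
  exists (j k, j k.+1); split=> /=; last exact: ltW.
  rewrite (_ : (fun q => _) = (fun q => (v q - p k q) + - (v q - p k.+1 q))); last first.
    by apply/funext => q /=; rewrite -/(p k.+1) -/(p k); ring.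
  apply: le_trans (tot_sqr_le2 _ _) _; rewrite (tot_sqrN (fun q => v q - p k.+1 q)).
  by rewrite exprS; apply: aux2 (jP k) _; rewrite -exprS; exact: (jP k.+1).
have chain J : (J <= K)%N ->
    `|swap_diff s v| <= \sum_(k < J) chain_bound k + `|swap_diff s (fun q => v q - p J q)|.
  elim: J => [_|J IH JK].
    rewrite big_ord0 add0r; rewrite (_ : (fun q => _) = v)//.
    by apply/funext => q; rewrite /p /= subr0.
  rewrite big_ord_recr/=; apply: le_trans (IH (ltnW JK)) _.
  rewrite -addrA lerD2l.
  rewrite (_ : (fun q => v q - p J q) =
      (fun q => (p J.+1 q - p J q) + (v q - p J.+1 q))); last first.
    by apply/funext => q; ring.
  rewrite swap_diffD; apply: le_trans (ler_normD _ _) _.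
  by rewrite lerD2r; exact: (link (Ordinal JK)).
apply: aux3 _ (sum_chain_bound K) (chain K (leqnn K)) vth.
rewrite -(@ler_pXn2r _ 2) ?nnegrE ?divr_ge0 ?(ltW theta0)// real_normK ?num_real//.
apply: le_trans (swap_diff_sqr_le _ _ n0) _; apply: le_trans KS.
by rewrite ler_pM2l//; exact: jP.
Qed.

(** If the false half stays below [S], the total is at most [S + 4 * sigma ^+ 2 <= 2 * S] and
    chaining applies; otherwise the vector is unbalanced. The constant is 2 + 4. *)
Theorem sign_deviation_bound : M ^+ 3 * expR (- L) <= 1 / 2 ->
  sign_frac [set s | exists2 v, V v &
    5 / 2 * theta < `|swap_diff s v| /\ avg_sqr true (swap s v) <= 4 * sigma ^+ 2] <=
  6 * (M ^+ 3 * expR (- L)).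
Proof.
move=> y2.
apply: (@le_trans _ _ (sign_frac ([set s | exists2 v, V v &
    S < avg_sqr false (swap s v) /\ avg_sqr true (swap s v) <= 4 * sigma ^+ 2] `|`
  [set s | exists2 v, V v & tot_sqr v <= 2 * S /\ 5 / 2 * theta < `|swap_diff s v|]))).
  apply: le_sign_frac => s [v Vv [vd vs]].
  have [Sv|vS] := ltP S (avg_sqr false (swap s v)); [left|right]; exists v => //.
  split=> //; rewrite -(tot_sqr_swap s) /tot_sqr.
  by have := sqr_ge0 sigma; have := S64; lra.
apply: le_trans (sign_fracU _ _) _.
have := unbalanced_sqr; have := balanced_chaining y2.
have : M * expR (- L) <= M ^+ 3 * expR (- L).
  by rewrite ler_wpM2r ?expR_ge0// -[leLHS]expr1 ler_weXn2l.
by lra.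
Qed.

End double_sample.

(** * Measurable projection *)

Section thick.
Context d (T : measurableType d) (R : realType).
Variable mu : {finite_measure set T -> \bar R}.

(** The outer measure exceeds [c], in terms of measurable covers. *)
Definition thick (c : \bar R) (S : set T) :=
  forall A, measurable A -> S `<=` A -> (c < mu A)%E.

(** Outer measure is continuous along increasing sequences of arbitrary sets: covers of measure at
    most [c] become increasing once each is replaced by the intersection of all later ones. *)
Lemma thick_bigcup c (S : nat -> set T) : nondecreasing_seq S ->
  thick c (\bigcup_n S n) -> exists n, thick c (S n).
Proof.
move=> ndS cS; apply: contrapT => /forallNP nS.
have /choice[A Ap] : forall n, exists A,
    [/\ measurable A, S n `<=` A & (mu A <= c)%E].
  move=> n; have /existsNP[A /not_implyP[mA /not_implyP[SA /negP]]] := nS n.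
  by rewrite -leNgt => cA; exists A.
pose B n := \bigcap_(m in [set m | (n <= m)%N]) A m.
have mB n : measurable (B n).
  by apply: bigcap_measurable => [|m _]; [exists n => /=|case: (Ap m)].
have mUB : measurable (\bigcup_n B n) by exact: bigcup_measurable.
have SB : \bigcup_n S n `<=` \bigcup_n B n.
  move=> x [n _ Snx]; exists n => // m /= nm; case: (Ap m) => _ + _; apply.
  by move: x Snx; apply/subsetPset/ndS.
have := cS _ mUB SB; apply/negP; rewrite -leNgt.
have ndB : nondecreasing_seq B.
  by move=> m n mn; apply/subsetPset => x Bx k /= nk; apply: Bx => /=; exact: leq_trans nk.
have /cvg_lim <- // := nondecreasing_cvg_mu (mu := mu) mB mUB ndB.
apply: lime_le.
  by apply: ereal_nondecreasing_is_cvgn => m n mn; rewrite le_measure ?inE//; exact/subsetPset/ndB.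
apply: nearW => n; case: (Ap n) => mA _; apply: le_trans.
by rewrite le_measure ?inE//; apply: bigcap_inf => /=.
Qed.

End thick.

(** * Suslin schemes over measurable-by-closed rectangles *)

Section suslin.
Context d (T : measurableType d) (Z : topologicalType).

(** Finite unions are included so that a bounded stage of a Suslin scheme stays in the class; second
    factors are closed so that compactness can act on sections. *)
Inductive paving : set (T * Z) -> Prop :=
| paving_rect A C : measurable A -> closed C -> paving (A `*` C)
| paving_union E F : paving E -> paving F -> paving (E `|` F).

Lemma paving0 : paving set0.
Proof. by rewrite -(set0X set0); apply: paving_rect; [exact: measurable0|exact: closed0]. Qed.

Lemma pavingT : paving setT.
Proof. by rewrite -setXTT; apply: paving_rect; [exact: measurableT|exact: closedT]. Qed.

Lemma pavingI E F : paving E -> paving F -> paving (E `&` F).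
Proof.
elim=> {E}[A C mA cC|E1 E2 _ IH1 _ IH2] pF; last first.
  by rewrite setIUl; apply: paving_union; [exact: IH1|exact: IH2].
elim: pF => {F}[B D mB cD|F1 F2 _ IH1 _ IH2].
  by rewrite -setXI; apply: paving_rect; [exact: measurableI|exact: closedI].
by rewrite setIUr; apply: paving_union.
Qed.

Lemma measurable_paving_proj E (D : set Z) : paving E ->
  measurable (fst @` (E `&` (setT `*` D))).
Proof.
elim=> {E}[A C mA cC|E1 E2 _ IH1 _ IH2]; last first.
  by rewrite setIUl image_setU; exact: measurableU.
have [CD0|/set0P[z [Cz Dz]]] := eqVneq (C `&` D) set0.
  rewrite -setXI CD0 setX0 image_set0; exact: measurable0.
rewrite (_ : _ @` _ = A)// eqEsubset; split=> [_ [[x y] [[/= Ax _] _] <-]//|x Ax].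
by exists (x, z).
Qed.

Lemma closed_paving_section E x : paving E -> closed [set z | E (x, z)].
Proof.
elim=> {E}[A C mA cC|E1 E2 _ IH1 _ IH2]; last exact: closedU.
have [Ax|nAx] := pselect (A x).
  by rewrite (_ : [set _ | _] = C)// eqEsubset; split=> z //= [].
by rewrite (_ : [set _ | _] = set0); [exact: closed0|rewrite -subset0 => z []].
Qed.

Definition agree (N : nat) (f g : nat -> nat) := forall i, (i < N)%N -> f i = g i.

(** The Suslin operation with whole sequences as indices: invariance under [agree k] says that the
    [k]-th set sees only the first [k] entries. *)
Definition suslin (E : set (T * Z)) := exists P : nat -> (nat -> nat) -> set (T * Z),
  [/\ forall k f, paving (P k f),
      forall k f g, agree k f g -> P k f = P k g
    & E = [set p | exists f, forall k, P k f p]].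

(* Delaying each constraint until enough of [f] is known normalizes an arbitrary modulus. *)
Lemma suslinW (P : nat -> (nat -> nat) -> set (T * Z)) :
  (forall k f, paving (P k f)) ->
  (forall k, exists N, forall f g, agree N f g -> P k f = P k g) ->
  suslin [set p | exists f, forall k, P k f p].
Proof.
move=> pP /choice[N NP].
pose fstc c := odflt 0%N (omap fst (unpickle c : option (nat * nat))).
have fstcK (k m : nat) : fstc (pickle (k, m)) = k by rewrite /fstc pickleK.
exists (fun c f => if (N (fstc c) <= c)%N then P (fstc c) f else setT); split.
- by move=> c f; case: ifP => // _; exact: pavingT.
- move=> c f g fg; case: ifP => // Nc; apply: NP => i iN; apply: fg => //.
  exact: leq_trans iN Nc.
- apply/seteqP; split=> p [f fP]; exists f => k.
    by case: ifP => // _.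
  have [m Nm] : exists m : nat, (N k <= pickle (k, m))%N.
    apply: contrapT => /forallNP nm.
    have Hm (m : nat) : (pickle (k, m) < N k)%N by rewrite ltnNge; exact/negP/nm.
    pose h (m : 'I_(N k).+1) := Ordinal (Hm m).
    have hi : injective h.
      move=> m1 m2 /(congr1 val)/= /(pcan_inj pickleK)[].
      exact: val_inj.
    by have := leq_card _ hi; rewrite !card_ord ltnn.
  by have := fP (pickle (k, m)); rewrite fstcK Nm.
Qed.

Lemma suslin_paving E : paving E -> suslin E.
Proof.
move=> pE; exists (fun _ _ => E); split=> //.
by apply/seteqP; split=> [p Ep|p [_ /(_ 0%N)]//]; exists id.
Qed.

(** The first entry of a branch chooses [n]; the shifted rest is a branch for [E n]. *)
Lemma suslin_bigcup (E : nat -> set (T * Z)) : (forall n, suslin (E n)) ->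
  suslin (\bigcup_n E n).
Proof.
move=> /choice[P PE].
rewrite (_ : \bigcup_n E n =
    [set p | exists f, forall k, P (f 0%N) k (f \o S) p]); last first.
  apply/seteqP; split=> p.
    move=> [n _]; case: (PE n) => _ _ -> [f fP].
    by exists (fun i => if i is j.+1 then f j else n).
  move=> [f fP]; exists (f 0%N) => //; case: (PE (f 0%N)) => _ _ -> /=.
  by exists (f \o S).
apply: suslinW => [k f|k]; first by case: (PE (f 0%N)).
exists k.+1 => f g fg; rewrite (fg 0%N)//.
by case: (PE (g 0%N)) => _ + _; apply => i ik; exact: fg.
Qed.

(** One branch encodes a whole sequence of branches through the pairing of indices. *)
Lemma suslin_bigcap (E : nat -> set (T * Z)) : (forall n, suslin (E n)) ->
  suslin (\bigcap_n E n).
Proof.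
move=> /choice[P PE].
pose dec c := odflt (0%N, 0%N) (unpickle c : option (nat * nat)).
have decK (i j : nat) : dec (pickle (i, j)) = (i, j) by rewrite /dec pickleK.
rewrite (_ : \bigcap_n E n = [set p | exists f, forall c,
    P (dec c).1 (dec c).2 (fun m => f (pickle ((dec c).1, m))) p]); last first.
  apply/seteqP; split=> p.
    move=> Ep; have /choice[f fP] : forall n, exists f, forall k, P n k f p.
      by move=> n; have := Ep n I; case: (PE n) => _ _ ->.
    exists (fun c => f (dec c).1 (dec c).2) => c.
    rewrite (_ : (fun m => _) = f (dec c).1)//.
    by apply/funext => m; rewrite decK.
  move=> [f fP] n _; case: (PE n) => _ _ -> /=.
  exists (fun m => f (pickle (n, m))) => k.
  by have := fP (pickle (n, k)); rewrite decK.
apply: suslinW => [c f|c]; first by case: (PE (dec c).1).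
exists (\max_(m < (dec c).2) pickle ((dec c).1, val m)).+1 => f g fg.
case: (PE (dec c).1) => _ + _; apply => i ik; apply: fg.
by rewrite ltnS (leq_bigmax (Ordinal ik)).
Qed.

(** Complements do not preserve Suslin sets in general; asking for both sides restores a
    sigma-algebra, so it is enough to treat generators. *)
Definition bisuslin E := suslin E /\ suslin (~` E).

Lemma bisuslin_sigma_algebra : sigma_algebra setT bisuslin.
Proof.
split.
- split; first exact/suslin_paving/paving0.
  by rewrite setC0; exact/suslin_paving/pavingT.
- by move=> A [sA sCA]; rewrite setTD; split=> //; rewrite setCK.
- move=> F sF; split; first by apply: suslin_bigcup => n; case: (sF n).
  by rewrite setC_bigcup; apply: suslin_bigcap => n; case: (sF n).
Qed.

(** A prefix of length [N] bounded by [b] takes finitely many values, so the union is a finite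
    one. *)
Lemma paving_bigcup_le (Q : (nat -> nat) -> set (T * Z)) (b : nat -> nat) N :
  (forall f, paving (Q f)) -> (forall f g, agree N f g -> Q f = Q g) ->
  paving (\bigcup_(f in [set f | forall i, (f i <= b i)%N]) Q f).
Proof.
elim: N Q => [|N IH] Q pQ QN.
  rewrite (_ : \bigcup_(f in _) _ = Q b)//; apply/seteqP; split=> p.
    by move=> [f _]; rewrite (QN f b).
  by move=> Qb; exists b => /=.
pose upd m (f : nat -> nat) i := if i == N then m else f i.
pose V M := \bigcup_(m in [set m | (m < M)%N])
  \bigcup_(f in [set f | forall i, (f i <= b i)%N]) Q (upd m f).
have pV M : paving (V M).
  elim: M => [|M IHM].
    rewrite (_ : V 0%N = set0); first exact: paving0.
    by rewrite -subset0 => p [].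
  rewrite (_ : V M.+1 = V M `|` \bigcup_(f in [set f | forall i, (f i <= b i)%N]) Q (upd M f)).
    apply: paving_union => //; apply: IH => // f g fg; apply: QN => i.
    by rewrite ltnS leq_eqVlt /upd; case: eqP => //= _; exact: fg.
  apply/seteqP; split=> p.
    move=> [m /=]; rewrite ltnS leq_eqVlt => /orP[/eqP ->|mM]; first by right.
    by move=> ?; left; exists m.
  move=> [[m /= mM] ?|?]; first by exists m => //=; exact: ltnW.
  by exists M => /=.
rewrite (_ : \bigcup_(f in _) _ = V (b N).+1)//; apply/seteqP; split=> p.
  move=> [f /= fb Qf]; exists (f N); first by rewrite /= ltnS.
  exists f => //; rewrite (QN _ f)// => i _; rewrite /upd.
  by case: eqP => // ->.
move=> [m /= mb [f /= fb Qf]]; exists (upd m f) => //= i.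
by rewrite /upd; case: eqP => // ->.
Qed.

End suslin.

(** * Choquet capacitability of projections *)

Section capacity.
Context d (T : measurableType d) (R : realType) (Z : topologicalType).
Variable mu : {finite_measure set T -> \bar R}.

(* Koenig's lemma and the compactness of [D], both read off one ultrafilter on the levels. *)
Lemma suslin_compact_branch (P : nat -> (nat -> nat) -> set (T * Z))
    (D : set Z) (b : nat -> nat) (x : T) :
  (forall k f, paving (P k f)) ->
  (forall k f g, agree k f g -> P k f = P k g) ->
  compact D ->
  (forall k, exists f z, [/\ forall i, (f i <= b i)%N, D z &
    forall j, (j <= k)%N -> P j f (x, z)]) ->
  exists f z, D z /\ forall j, P j f (x, z).
Proof.
move=> pP lP cD /choice[f] /choice[z fz].
have [U [UU Uoo]] := ultraFilterLemma (@eventually_filter).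
have UF : ProperFilter U := @ultra_proper _ _ UU.
have [z0 [Dz0 cz0]] : D `&` cluster (z @ U) !=set0.
  apply: cD; apply: Uoo; exists 0%N => // k _ /=.
  by case: (fz k).
have Ufin i : exists m, U [set k | f k i = m].
  have : U [set k | (f k i <= b i)%N].
    by apply: Uoo; exists 0%N => // k _ /=; case: (fz k).
  elim: (b i) => [|B IH] UB.
    by exists 0%N; apply: filterS UB => k /=; rewrite leqn0 => /eqP.
  have [UE|UE] := in_ultra_setVsetC [set k | f k i = B.+1] UU; first by exists B.+1.
  apply: IH; apply: filterS (filterI UB UE) => k /= [].
  by rewrite leq_eqVlt => /orP[/eqP fkB /(_ fkB)|].
have [g gU] := choice Ufin.
exists g, z0; split=> // j.
have Uj : U [set k | P j g (x, z k)].
  have Ug N : U [set k | agree N (f k) g].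
    elim: N => [|N IH]; first by apply: filterS (@filterT _ U _) => k _ i.
    apply: filterS (filterI IH (gU N)) => k /= [kN kgN] i.
    by rewrite ltnS leq_eqVlt => /orP[/eqP ->|]//; exact: kN.
  have Uj : U [set k | (j <= k)%N] by apply: Uoo; exists j.
  apply: filterS (filterI (Ug j) Uj) => k /= [fg jk].
  by rewrite -(lP _ _ _ fg); case: (fz k) => _ _; apply.
apply: (closed_paving_section (pP j g)) => B nB.
by apply: cz0 => //; exact: Uj.
Qed.

(** Bounds [b] on the entries of the branches are chosen one by one so that the projection of what
    remains stays thick. The finite stages [L k] then project to decreasing measurable sets of
    measure at least [c], and a point of all of them lies under a full branch by compactness. *)
Lemma capacitability (E : set (T * Z)) (D : set Z) (c : \bar R) : suslin E ->
  compact D -> thick mu c (fst @` (E `&` (setT `*` D))) ->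
  exists B, [/\ measurable B, B `<=` fst @` E & (c <= mu B)%E].
Proof.
move=> [P [pP lP EP]] cD cE.
pose S (s : seq nat) : set T := fst @` ([set p | exists f : nat -> nat,
   (forall i, (i < size s)%N -> (f i <= nth 0 s i)%N) /\ forall j, P j f p]
   `&` (setT `*` D)).
have S0 : thick mu c (S [::]).
  rewrite (_ : S [::] = fst @` (E `&` (setT `*` D)))// EP.
  congr (fst @` (_ `&` _)); apply/seteqP; split=> p [f].
    by move=> [_ ?]; exists f.
  by move=> fP; exists f; split.
have /choice[g gS] : forall s, exists m,
    thick mu c (S s) -> thick mu c (S (rcons s m)).
  move=> s; have [tS|] := pselect (thick mu c (S s)); last by exists 0%N.
  suff [m tm] : exists m, thick mu c (S (rcons s m)) by exists m.
  apply: thick_bigcup.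
    move=> m n mn; apply/subsetPset => _ [p [[f [fs fP]] Dp] <-].
    exists p => //; split=> //; exists f; split=> // i; rewrite size_rcons => i1.
    apply: leq_trans (fs i _) _; first by rewrite size_rcons.
    by rewrite !nth_rcons; case: ifP => // _; case: ifP.
  rewrite (_ : \bigcup_n _ = S s)//; apply/seteqP; split=> x.
    move=> [m _ [p [[f [fs fP]] Dp] <-]]; exists p => //; split=> //.
    exists f; split=> // i si; have := fs i.
    by rewrite size_rcons nth_rcons si; apply; exact: ltnW.
  move=> [p [[f [fs fP]] Dp] <-]; exists (f (size s)) => //.
  exists p => //; split=> //; exists f; split=> // i; rewrite size_rcons ltnS.
  rewrite leq_eqVlt nth_rcons => /orP[/eqP ->|si]; first by rewrite ltnn eqxx.
  by rewrite si; exact: fs.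
pose seqb k := iter k (fun s => rcons s (g s)) [::].
pose b k := g (seqb k).
have seqbE k : seqb k = mkseq b k.
  by elim: k => // k IH; rewrite mkseqS -IH.
have tb k : thick mu c (S (mkseq b k)).
  by rewrite -seqbE; elim: k => // k IH; exact: gS.
pose L k := \bigcup_(f in [set f : nat -> nat | forall i, (f i <= b i)%N])
  \bigcap_(j in [set j | (j <= k)%N]) P j f.
have pL k : paving (L k).
  apply: (@paving_bigcup_le _ _ _ _ _ k) => [f|f g' fg].
    elim: k => [|k IH].
      rewrite (_ : \bigcap_(j in _) _ = P 0%N f)//; apply/seteqP; split=> p.
        by apply.
      by move=> Pp j /=; rewrite leqn0 => /eqP ->.
    rewrite (_ : \bigcap_(j in _) _ = \bigcap_(j in [set j | (j <= k)%N]) P j f `&` P k.+1 f).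
      exact: pavingI.
    apply/seteqP; split=> p.
      by move=> H; split=> [j /= jk|]; apply: H => //=; exact: leqW.
    by move=> [H1 H2] j /=; rewrite leq_eqVlt => /orP[/eqP ->|jk]//; exact: (H1 j jk).
  by apply: eq_bigcapr => j /= jk; apply: lP => i ij; apply: fg; exact: leq_trans ij jk.
pose B k := fst @` (L k `&` (setT `*` D)).
have mB k : measurable (B k) by exact: measurable_paving_proj.
have niB : nonincreasing_seq B.
  move=> m n mn; apply/subsetPset => _ [p [[f fb fP] Dp] <-].
  exists p => //; split=> //; exists f => // j /= jm; apply: fP => /=.
  exact: leq_trans jm mn.
have cB k : (c <= mu (B k))%E.
  apply/ltW/(tb k) => // _ [p [[f [fs fP]] Dp] <-]; exists p => //; split=> //.
  (* Only the first [k] entries are known to be bounded by [b]; the others are reset to 0, unseen by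
     [P j] for [j <= k]. *)
  exists (fun i => if (i < k)%N then f i else 0%N) => /= [i|j jk].
    case: ifP => // ik; have := fs i; rewrite size_mkseq nth_mkseq//; exact.
  rewrite (lP _ _ f)// => i ij.
  by rewrite (leq_trans ij jk).
have mIB : measurable (\bigcap_k B k) by exact: bigcapT_measurable.
exists (\bigcap_k B k); split=> //.
  move=> x Bx.
  have [k|f [z [Dz fz]]] := @suslin_compact_branch P D b x pP lP cD.
    have [[x' z] [[f fb fP] [_ Dz]] /= xx'] := Bx k I.
    by exists f, z; split => // j jk; rewrite -xx'; exact: fP.
  by exists (x, z) => //; rewrite EP; exists f.
have /cvg_lim <- // : mu \o B @ \oo --> mu (\bigcap_k B k).
  by apply: nonincreasing_cvg_mu => //; rewrite ltey_eq fin_num_measure.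
apply: lime_ge.
  by apply: ereal_nonincreasing_is_cvgn => m n mn; rewrite le_measure ?inE//; exact/subsetPset/niB.
exact: nearW.
Qed.

End capacity.

Section projection.
Context d (T : measurableType d) (R : realType) (m : nat).
Local Notation Z := 'rV[R]_m.

(** Pulling back reduces the claim to rectangles and to closed rays in one coordinate. The
    complement of a closed ray is an open ray, a countable union of closed ones. *)
Lemma measurable_bisuslin (E : set (T * Z)) : measurable E -> bisuslin E.
Proof.
move=> mE; apply: (smallest_sub (@bisuslin_sigma_algebra _ T Z) _ mE).
have pull (V : Type) (h : T * Z -> V) :
  sigma_algebra setT [set B | bisuslin (h @^-1` B)].
  have [bs0 bsC bsU] := @bisuslin_sigma_algebra _ T Z.
  split=> /=.
  - by rewrite preimage_set0.
  - by move=> A /bsC; rewrite !setTD.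
  - by move=> F /bsU; rewrite preimage_bigcup.
move=> A []; rewrite /preimage_set_system/= => -[B mB <-]; rewrite setTI.
  split; apply: suslin_paving.
    rewrite (_ : _ @^-1` _ = B `*` setT); last by apply/seteqP; split=> p //= [].
    by apply: paving_rect => //; exact: closedT.
  rewrite (_ : ~` _ = ~` B `*` setT); last by apply/seteqP; split=> p //= [].
  by apply: paving_rect; [exact: measurableC|exact: closedT].
apply: (smallest_sub (pull _ snd) _ mB) => {B mB} B.
rewrite -bigcup_seq/= => -[i _ [A' mA' <-]]; rewrite setTI.
pose h (p : T * Z) : R := p.2 ord0 i.
have : (@ocitv R).-sigma.-measurable A' by exact: mA'.
rewrite measurable_realfun.RGenCInfty.measurableE => {}mA'.
apply: (smallest_sub (pull _ h) _ mA') => _ [a ->].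
have pc (F : set R) : closed F -> suslin (h @^-1` F).
  move=> cF; apply: suslin_paving.
  rewrite (_ : h @^-1` F = setT `*` ((fun v : Z => v ord0 i) @^-1` F)); last first.
    by apply/seteqP; split=> p //= [].
  apply: paving_rect => //; apply: closed_comp => // v _.
  exact: coord_continuous.
split; first by apply: pc; rewrite set_itvE; exact: closed_ge.
rewrite (_ : ~` _ = \bigcup_n (h @^-1` `]-oo, (a - n.+1%:R^-1)])).
  by apply: suslin_bigcup => n; apply: pc; rewrite set_itvE; exact: closed_le.
apply/seteqP; split=> p /=; rewrite in_itv/= andbT.
  move=> /negP; rewrite -ltNge -subr_gt0 => pa.
  have [n np] := ltr_add_invr pa; rewrite add0r in np.
  by exists n => //=; rewrite in_itv/= lerBrDr -lerBrDl ltW.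
move=> [n _]; rewrite /= in_itv/= => pn; apply/negP; rewrite -ltNge.
by rewrite (le_lt_trans pn)// ltrBlDr ltrDl invr_gt0.
Qed.

(** Inner measure controls outer measure here: if the projection were thick, so would be the part
    over some compact cube, and capacitability would produce a measurable subset of measure at least
    [c]. *)
Theorem measurable_projection (mu : {finite_measure set T -> \bar R})
    (E : set (T * Z)) (c : \bar R) : measurable E ->
  (forall B, measurable B -> B `<=` fst @` E -> (mu B < c)%E) ->
  exists A, [/\ measurable A, fst @` E `<=` A & (mu A <= c)%E].
Proof.
move=> mE Ec; apply: contrapT => /forallNP nA.
have : thick mu c (fst @` E).
  move=> A mA EA; rewrite ltNge; apply/negP => Ac; exact: (nA A).
pose D k : set Z := [set v | forall i, v ord0 i \in `[- k%:R, k%:R] ].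
have -> : fst @` E = \bigcup_k fst @` (E `&` (setT `*` D k)).
  apply/seteqP; split=> x; last by move=> [k _ [p [Ep _] <-]]; exists p.
  move=> [p Ep <-].
  pose k := \max_(i < m) (Num.trunc `|p.2 ord0 i|).+1.
  exists k => //; exists p => //; split=> //; split=> // i /=.
  rewrite in_itv/= -ler_norml ltW// (lt_le_trans (truncnS_gt _))// ler_nat.
  exact: (leq_bigmax i).
move=> /thick_bigcup[|k tk].
  move=> k l kl; apply/subsetPset => _ [p [Ep [_ Dp]] <-].
  exists p => //; split=> //; split=> // i; have := Dp i.
  by apply: subitvP; rewrite subitvE !bnd_simp lerN2 ler_nat kl.
have cD : compact (D k).
  have := @rV_compact R m (fun=> `[- k%:R : R, k%:R]%classic).
  by apply => i; exact: segment_compact.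
have [sE _] := measurable_bisuslin mE.
have [B [mB BE cB]] := capacitability sE cD tk.
by have := Ec B mB BE; rewrite ltNge cB.
Qed.

End projection.

(** * Symmetrization *)

Section boxes.
Context {dV} {V : measurableType dV} {n : nat}.

Definition boxes : set (set (bool * 'I_n -> V)) :=
  [set A | exists2 B : bool * 'I_n -> set V, (forall p, measurable (B p)) &
    A = [set z | forall p, B p (z p)]].

Lemma boxes_setI : setI_closed boxes.
Proof.
move=> _ _ [A mA ->] [B mB ->]; exists (fun p => A p `&` B p).
  by move=> p; exact: measurableI.
apply/seteqP; split=> z /=; first by move=> [Az Bz] p; split.
by move=> H; split=> p; case: (H p).
Qed.

Lemma boxesT : boxes setT.
Proof. by exists (fun=> setT) => //; apply/seteqP; split. Qed.

End boxes.

(** Boxes are stable under intersection, hence determine laws, and a swap merely permutes their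
    sides. *)
Notation double_sample R d n := (g_sigma_algebraType (@boxes _ 'rV[R]_d n)).

Section double_sample_space.
Context {R : realType} {d n : nat}.
Local Notation T := (double_sample R d n).

Lemma measurable_eval (p : bool * 'I_n) :
  measurable_fun setT (fun z : T => z p).
Proof.
move=> _ B mB; rewrite setTI; apply: sub_sigma_algebra.
exists (fun q => if q == p then B else setT); first by move=> q; case: ifP.
apply/seteqP; split=> z /=; last by move=> /(_ p); rewrite eqxx.
by move=> Bz q; case: eqP => // ->.
Qed.

Lemma measurable_to_sample dU (U : measurableType dU) (f : U -> T) :
  (forall p, measurable_fun setT (fun u => f u p)) -> measurable_fun setT f.
Proof.
move=> mf; apply: (@measurability _ _ U T setT f (@boxes _ 'rV[R]_d n)) => //.
move=> _ [_ [B mB ->] <-]; rewrite setTI.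
rewrite (_ : _ @^-1` _ = \bigcap_(p in setT) ((fun u => f u p) @^-1` B p)).
  apply: fin_bigcap_measurable; first exact: finite_finset.
  by move=> p _; rewrite -[X in measurable X]setTI; exact: mf.
by apply/seteqP; split=> u /= Bu p; [move=> _; exact: Bu|exact: (Bu p)].
Qed.

Lemma measurable_swap s : measurable_fun setT (swap s : T -> T).
Proof. by apply: measurable_to_sample => p; exact: measurable_eval. Qed.

HB.instance Definition _ s := isMeasurableFun.Build _ _ _ _ (swap s : T -> T) (measurable_swap s).

Lemma sample_measure_unique (m1 m2 : probability T R) :
  (forall A, boxes A -> m1 A = m2 A) -> forall A, measurable A -> m1 A = m2 A.
Proof.
move=> m12 A mA.
apply: (@measure_unique _ R T boxes (fun=> setT)) => //.
- exact: boxes_setI.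
- by move=> _; exact: boxesT.
- by rewrite bigcup_const.
- by move=> k; have /= -> := probability_setT m1; rewrite ltry.
Qed.

End double_sample_space.

Section symmetrization.
Context {R : realType} {d n : nat} {disp : measure_display}
  {Omega : measurableType disp} (Pr : probability Omega R)
  (P : probability 'rV[R]_d R) (xi : 'I_n -> {RV Pr >-> 'rV[R]_d}).
Hypothesis iidP : iid P xi.
Local Notation T := (double_sample R d n).

Definition pair_sample (w : Omega * Omega) : T :=
  fun p => xi p.2 (if p.1 then w.2 else w.1).

Lemma measurable_pair_sample : measurable_fun setT pair_sample.
Proof.
apply: measurable_to_sample => -[[] i]; apply: measurableT_comp => //.
Qed.

HB.instance Definition _ := isMeasurableFun.Build _ _ _ _ pair_sample measurable_pair_sample.

(** The ghost sample is [xi] evaluated on an independent second copy of [Omega]. *)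
Definition sample_law : probability T R := distribution (Pr \x Pr)%E pair_sample.

Lemma iid_box (B : 'I_n -> set 'rV[R]_d) : (forall i, measurable (B i)) ->
  Pr [set w | forall i, B i (xi i w)] = (\prod_i P (B i))%E.
Proof.
move=> mB; have [iP iI] := iidP.
rewrite (_ : [set _ | _] = \bigcap_(i in [set` [set: 'I_n]%SET]) (xi i @^-1` B i)).
  rewrite iI//; apply: eq_big => i; first by rewrite inE.
  by move=> _; exact: iP.
apply/seteqP; split=> w /= H i; first by move=> _; exact: H.
by apply: H; rewrite /= inE.
Qed.

Lemma sample_law_box (B : bool * 'I_n -> set 'rV[R]_d) : (forall p, measurable (B p)) ->
  sample_law [set z | forall p, B p (z p)] = (\prod_p P (B p))%E.
Proof.
move=> mB; rewrite /sample_law/= /distribution /pushforward.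
have mX b : measurable [set w | forall i, B (b, i) (xi i w)].
  rewrite (_ : [set _ | _] = \bigcap_(i in setT) (xi i @^-1` B (b, i))).
    apply: fin_bigcap_measurable; first exact: finite_finset.
    by move=> p _; rewrite -[X in measurable X]setTI; exact: measurable_funP.
  by apply/seteqP; split=> u /= Bu p; [move=> _; exact: Bu|exact: (Bu p)].
rewrite (_ : _ @^-1` _ = [set w | forall i, B (false, i) (xi i w)] `*`
    [set w | forall i, B (true, i) (xi i w)]); last first.
  apply/seteqP; split=> -[w w'] /=.
    by move=> H; split=> i; [exact: (H (false, i))|exact: (H (true, i))].
  by move=> [H0 H1] [[] i]; [exact: H1|exact: H0].
have iB b := iid_box (fun i => mB (b, i)).
rewrite product_measure1E//; apply: (etrans (congr2 mule (iB false) (iB true))).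
transitivity (\prod_(b : bool) \prod_i P (B (b, i)))%E.
  by rewrite big_bool/= muleC.
by rewrite pair_bigA; apply: eq_bigr => -[].
Qed.

Lemma sample_law_swap s (A : set T) : measurable A ->
  sample_law (swap s @^-1` A) = sample_law A.
Proof.
move=> mA.
apply: (@sample_measure_unique _ _ _ (distribution sample_law (swap s)) sample_law) => //.
move=> _ [B mB ->]; rewrite /distribution /pushforward/=.
rewrite (_ : _ @^-1` _ = [set z : T | forall p, swap s B p (z p)]); last first.
  apply/seteqP; split=> z /= H [b i]; have := H (b (+) s i, i); rewrite /swap/=.
    by rewrite addbK.
  by rewrite -addbA addbb addbF.
have msB p : measurable (swap s B p) by exact: mB.
apply: (etrans (sample_law_box msB)); apply: (etrans _ (esym (sample_law_box mB))).
rewrite [RHS](reindex (fun p : bool * 'I_n => (p.1 (+) s p.2, p.2)))//=.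
by exists (fun p : bool * 'I_n => (p.1 (+) s p.2, p.2)) => -[b i] _; rewrite /= addbK.
Qed.

(** By swap invariance the measure of [A] is the average of the measures of its swapped preimages,
    that is, the integral of a sign frequency. *)
Lemma sample_law_le_sign_frac (A : set T) (e : R) : measurable A ->
  (forall z, sign_frac [set s | A (swap s z)] <= e) -> (sample_law A <= e%:E)%E.
Proof.
move=> mA Ae.
have mI s : measurable (swap s @^-1` A : set T).
  by rewrite -[_ @^-1` _]setTI; exact: measurable_swap.
have mF s : measurable_fun setT (EFin \o (\1_(swap s @^-1` A : set T) : T -> R)).
  by apply/measurable_EFinP; exact: measurable_indic.
pose g (z : T) : \bar R := (((2 ^+ n)^-1)%:E * \sum_s (\1_(swap s @^-1` A : set T) z)%:E)%E.
have gE z : g z = (sign_frac [set s | A (swap s z)])%:E.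
  rewrite /g /sign_frac sumEFin -EFinM; congr (_ * _)%:E; apply: eq_bigr => s _.
have g0 z : (0 <= g z)%E.
  by rewrite mule_ge0// ?lee_fin ?invr_ge0 ?exprn_ge0// sume_ge0// => s _; rewrite lee_fin indicE.
have mg : measurable_fun setT g.
  by apply: measurable_funeM; exact: emeasurable_sum.
have -> : sample_law A = (\int[sample_law]_z g z)%E.
  rewrite ge0_integralZl//; last 2 first.
  - exact: emeasurable_sum.
  - by move=> z _; apply: sume_ge0 => s _; rewrite lee_fin indicE.
  rewrite ge0_integral_sum//.
  rewrite (eq_bigr (fun=> sample_law A)) => [|s _]; last first.
    by rewrite integral_indic// setIT; exact: sample_law_swap.
  have : sample_law A \is a fin_num by exact: fin_num_measure.
  move: (sample_law A) => [r| |]// _.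
  rewrite sumEFin -EFinM sumr_const -(mulr_natl r) card_ffun card_bool card_ord natrX.
  by rewrite mulrA mulVf ?mul1r// expf_neq0.
apply: (@le_trans _ _ (\int[sample_law]_z (cst e%:E) z)%E); last first.
  by rewrite integral_cst// [X in (_ * X)%E]probability_setT mule1.
by apply: ge0_le_integral => // z _; rewrite gE lee_fin.
Qed.

(** Measurable subsets of the projection of [E] have measure at most [e], so for [c > e] a
    measurable cover [A] of measure at most [c] exists. A bad [w] has a section in [A] of measure at
    least 1/2; by Markov's inequality such [w] have probability at most [2 * c]. *)
Theorem symmetrization m (E : set (T * 'rV[R]_m)) (e c : R) (Bad : set Omega) :
  measurable E -> e < c ->
  (forall z, sign_frac [set s | exists x, E (swap s z, x)] <= e) ->
  (forall w, Bad w -> exists x G, [/\ measurable G, ((1 / 2)%:E <= Pr G)%E &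
    forall w', G w' -> E (pair_sample (w, w'), x)]) ->
  exists H, [/\ measurable H, Bad `<=` H & (Pr H <= (2 * c)%:E)%E].
Proof.
move=> mE ec Ee BadE.
have [|A [mA EA Ac]] := @measurable_projection _ T R m sample_law E c%:E mE.
  move=> B mB BE; apply: (@le_lt_trans _ _ e%:E); last by rewrite lte_fin.
  apply: sample_law_le_sign_frac => // z; apply: le_trans (Ee z).
  by apply: le_sign_frac => s /= /BE[[z' x] Ex /= <-]; exists x.
pose A' := pair_sample @^-1` A.
have mA' : measurable A' by rewrite -[A']setTI; exact: measurable_pair_sample.
have mf : measurable_fun setT (Pr \o xsection A') by exact: measurable_fun_xsection.
exists [set w | ((1 / 2)%:E <= `|(Pr \o xsection A') w|)%E]; split.
- rewrite -[X in measurable X]setTI; apply: emeasurable_fun_c_infty => //.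
  exact: measurableT_comp.
- move=> w /BadE[x [G [mG G2 GE]]] /=; rewrite gee0_abs//; apply: (le_trans G2).
  rewrite le_measure ?inE//; first exact: measurable_xsection.
  move=> w' /GE Ew; rewrite /xsection/= inE; apply: EA.
  by exists (pair_sample (w, w'), x).
have := @le_integral_abse _ _ _ Pr setT measurableT _ (1 / 2) mf ltac:(lra).
rewrite setTI => H.
suff : ((1 / 2)%:E * Pr [set x | (1 / 2)%:E <= `|(Pr \o xsection A') x|] <= c%:E)%E.
  by rewrite -lee_pdivlMl// => H'; apply: (le_trans H'); rewrite -EFinM lee_fin; lra.
apply: (le_trans H); apply: le_trans Ac.
under eq_integral do rewrite gee0_abs//.
exact: lexx.
Qed.

End symmetrization.

(** * Moments of bounded functions of an i.i.d. sample *)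

Section bounded_moments.
Context {R : realType}.

Lemma bounded_prob_integrable dT (T : measurableType dT) (Q : probability T R)
    (f : T -> R) (M : R) : measurable_fun setT f -> (forall x, `|f x| <= M) ->
  Q.-integrable setT (EFin \o f).
Proof.
move=> mf fM; apply: measurable_bounded_integrable => //.
  by have /= -> := probability_setT Q; rewrite ltry.
exists M; split; first exact: num_real.
by move=> N MN x _; apply: le_trans (fM x) (ltW MN).
Qed.

Lemma prob_markov dT (T : measurableType dT) (Q : probability T R)
    (f : T -> R) (M a e : R) : measurable_fun setT f -> (forall x, 0 <= f x <= M) ->
  0 < a -> (\int[Q]_x f x)%R <= e * a -> (Q [set x | a <= f x]%R <= e%:E)%E.
Proof.
move=> mf fM a0 ie.
have fi : Q.-integrable setT (EFin \o f).
  apply: (@bounded_prob_integrable _ _ _ _ M) => // x.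
  by have /andP[f0 fM'] := fM x; rewrite ger0_norm.
have /measurable_EFinP mf' := mf.
have := @le_integral_abse _ _ _ Q setT measurableT _ a mf' a0.
rewrite setTI (_ : [set x | _] = [set x | a <= f x]%R); last first.
  by apply/seteqP; split=> x /=; rewrite lee_fin ger0_norm//; case/andP: (fM x).
rewrite (_ : (\int[Q]_(x in _) `|(EFin \o f) x|)%E = (\int[Q]_x f x)%:E%R); last first.
  rewrite fineK//; last exact: integrable_fin_num.
  by apply: eq_integral => x _ /=; rewrite ger0_norm//; case/andP: (fM x).
rewrite -lee_pdivlMl// => H; apply: (le_trans H).
by rewrite -EFinM lee_fin ler_pdivrMl// mulrC.
Qed.

Lemma bounded_Rintegral_sum dT (T : measurableType dT) (Q : probability T R)
    (I : finType) (F : I -> T -> R) (M : R) :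
  (forall i, measurable_fun setT (F i)) -> (forall i x, `|F i x| <= M) ->
  (\int[Q]_x (\sum_i F i x) = \sum_i \int[Q]_x F i x)%R.
Proof.
move=> mF FM; have Fi i := bounded_prob_integrable Q (mF i) (FM i).
rewrite /Rintegral; under eq_integral do rewrite -sumEFin.
by rewrite integral_sum// -sum_fine// => i _; exact: (integrable_fin_num measurableT (Fi i)).
Qed.

End bounded_moments.

Section empirical_mean.
Context {R : realType} {d n : nat} {disp : measure_display}
  {Omega : measurableType disp} (Pr : probability Omega R)
  (P : probability 'rV[R]_d R) (xi : 'I_n -> {RV Pr >-> 'rV[R]_d}).
Hypothesis iidP : iid P xi.

Lemma iid_law i (B : set 'rV[R]_d) : measurable B -> Pr (xi i @^-1` B) = P B.
Proof. exact: iidP.1. Qed.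

Lemma iid_pair_law i j (A : set ('rV[R]_d * 'rV[R]_d)) : i != j -> measurable A ->
  Pr ((fun w => (xi i w, xi j w)) @^-1` A) = (P \x P)%E A.
Proof.
move=> ij mA.
have mX : measurable_fun setT (fun w => (xi i w, xi j w)) by exact: measurable_fun_pair.
pose X : {mfun Omega >-> ('rV[R]_d * 'rV[R]_d)%type} := mfun_Sub (mem_set mX).
apply/esym/(product_measure_unique (m' := distribution Pr X)) => // B C mB mC.
have := iidP.2 [set i; j]%SET (fun k => if k == i then B else C).
rewrite big_setU1 ?inE//= big_set1 eqxx eq_sym (negbTE ij) !iid_law// => <-.
  congr (Pr _); apply/seteqP; split=> w /=.
    by move=> [Bw Cw] k /=; rewrite !inE => /orP[]/eqP ->; rewrite ?eqxx// eq_sym (negbTE ij).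
  move=> H; split; first by have := H i; rewrite /= !inE eqxx; apply.
  by have := H j; rewrite /= !inE eqxx orbT eq_sym (negbTE ij); apply.
by move=> k; case: ifP.
Qed.

Lemma iid_Rintegral i (g : 'rV[R]_d -> R) M : measurable_fun setT g ->
  (forall y, `|g y| <= M) -> \int[Pr]_w g (xi i w) = \int[P]_y g y.
Proof.
move=> mg gM; congr fine.
rewrite -(@integral_distribution _ _ _ _ _ Pr (xi i) (EFin \o g)).
- apply: eq_measure_integral => B mB _; exact: iid_law.
- exact/measurable_EFinP.
- apply: (@bounded_prob_integrable _ _ _ Pr (g \o xi i) M) => // [|w]; last exact: gM.
  exact: measurableT_comp.
Qed.

Lemma iid_Rintegral_mul i j (f : 'rV[R]_d -> R) M : i != j -> measurable_fun setT f ->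
  (forall y, `|f y| <= M) -> \int[P]_y f y = 0 ->
  \int[Pr]_w (f (xi i w) * f (xi j w)) = 0.
Proof.
move=> ij mf fM f0.
have mX : measurable_fun setT (fun w => (xi i w, xi j w)) by exact: measurable_fun_pair.
pose X : {mfun Omega >-> ('rV[R]_d * 'rV[R]_d)%type} := mfun_Sub (mem_set mX).
pose h (p : 'rV[R]_d * 'rV[R]_d) : R := f p.1 * f p.2.
have mh : measurable_fun setT h.
  by apply: measurable_funM; apply: measurableT_comp.
have hM p : `|h p| <= M * M by rewrite normrM ler_pM.
transitivity (fine (\int[P \x P]_p (h p)%:E)%E).
  congr fine; transitivity (\int[distribution Pr X]_p (h p)%:E)%E.
    rewrite integral_distribution//; first exact/measurable_EFinP.
    apply: (@bounded_prob_integrable _ _ _ Pr (h \o X) (M * M)) => // [|w]; last exact: hM.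
    by apply: measurableT_comp => //; exact: measurable_funP.
  apply: eq_measure_integral => B mB _; exact: iid_pair_law.
rewrite -integral12_prod_meas1; last exact: bounded_prob_integrable mh hM.
rewrite (eq_integral (cst 0%E)) ?integral0// => x _.
rewrite /fubini_F /h /=; under eq_integral do rewrite EFinM.
rewrite integralZl//; last exact: bounded_prob_integrable mf fM.
have fi : (\int[P]_y (f y)%:E)%E \is a fin_num.
  by apply: integrable_fin_num => //; exact: bounded_prob_integrable mf fM.
by rewrite -(fineK fi) [fine _]f0 mule0.
Qed.

(** Two failures of probability at most 1/4 each: Chebyshev for the mean, whose variance is at most
    [sigma ^+ 2 / n <= b ^+ 2 / 4], and Markov for the empirical second moment, whose expectation is
    at most [sigma ^+ 2]. *)
Theorem empirical_moments_half (g : 'rV[R]_d -> R) (U sigma b : R) : (0 < n)%N ->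
  measurable_fun setT g -> (forall y, `|g y| <= U) -> 0 < sigma ->
  \int[P]_y (g y ^+ 2) <= sigma ^+ 2 -> 0 < b -> 4 * sigma ^+ 2 <= n%:R * b ^+ 2 ->
  exists G, [/\ measurable G, ((1 / 2)%:E <= Pr G)%E & forall w, G w ->
    `|n%:R^-1 * \sum_i g (xi i w) - \int[P]_y g y| <= b /\
    n%:R^-1 * \sum_i g (xi i w) ^+ 2 <= 4 * sigma ^+ 2].
Proof.
move=> n0 mg gU sigma0 gs b0 sb.
have nR : 0 < n%:R :> R by rewrite ltr0n.
pose m := \int[P]_y g y; pose f y := g y - m.
have mf : measurable_fun setT f by exact: measurable_funB.
have fM y : `|f y| <= U + `|m|.
  by apply: le_trans (ler_normB _ _) _; rewrite lerD2r.
have gi := bounded_prob_integrable P mg gU.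
have mg2 : measurable_fun setT (fun y => g y ^+ 2) by exact: measurable_funX.
have g2U y : `|g y ^+ 2| <= U ^+ 2.
  by rewrite normrX ler_pXn2r ?nnegrE// (le_trans _ (gU y)).
have g2i := bounded_prob_integrable P mg2 g2U.
have f0 : \int[P]_y f y = 0.
  rewrite RintegralB//; last exact: (bounded_prob_integrable P (f := cst m) (M := `|m|)).
  by rewrite Rintegral_cst//; have /= -> := probability_setT P; rewrite mulr1 subrr.
have f2s : \int[P]_y (f y ^+ 2) <= sigma ^+ 2.
  apply: le_trans gs.
  have -> : \int[P]_y (f y ^+ 2) = \int[P]_y (g y ^+ 2 - (2 * m * g y - m ^+ 2)).
    by congr fine; apply: eq_integral => y _; congr EFin; rewrite /f; ring.
  have mi : P.-integrable setT (EFin \o (fun y => 2 * m * g y)).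
    apply: (bounded_prob_integrable P (M := `|2 * m| * U)) => [|y].
      exact: measurable_funM.
    by rewrite normrM ler_wpM2l.
  have ci (r : R) : P.-integrable setT (EFin \o (fun=> r)).
    exact: (bounded_prob_integrable P (f := cst r) (M := `|r|)).
  rewrite RintegralB// ?RintegralB//; last first.
    have := integrableB measurableT mi (ci (m ^+ 2)).
    by apply: eq_integrable => // y _.
  rewrite RintegralZl// -/m Rintegral_cst//.
  have /= -> := probability_setT P; rewrite mulr1 lerBlDr lerDl.
  by have := sqr_ge0 m; nra.
pose Y i w := f (xi i w).
have mY i : measurable_fun setT (Y i) by exact: measurableT_comp.
have YM i w : `|Y i w| <= U + `|m| by exact: fM.
have M0 : 0 <= U + `|m| := le_trans (normr_ge0 _) (fM 0).
(* Expanding the square leaves only the diagonal, since distinct centred terms are uncorrelated. *)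
have Y2 : \int[Pr]_w ((\sum_i Y i w) ^+ 2) <= n%:R * sigma ^+ 2.
  have -> : \int[Pr]_w ((\sum_i Y i w) ^+ 2) =
      \int[Pr]_w (\sum_(p : 'I_n * 'I_n) Y p.1 w * Y p.2 w).
    congr fine; apply: eq_integral => w _; congr EFin.
    rewrite expr2 mulr_suml -(pair_bigA _ (fun i j => Y i w * Y j w))/=.
    by apply: eq_bigr => i _; rewrite mulr_sumr.
  rewrite (@bounded_Rintegral_sum _ _ _ Pr _ (fun p w => Y p.1 w * Y p.2 w) ((U + `|m|) * (U + `|m|))); last 2 first.
  - by move=> p; exact: measurable_funM.
  - by move=> p w; rewrite normrM ler_pM.
  rewrite -(pair_bigA _ (fun i j => \int[Pr]_w (Y i w * Y j w)))/=.
  rewrite mulr_natl -[X in _ *+ X]card_ord -sumr_const; apply: ler_sum => i _.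
  rewrite (bigD1 i)//= big1 ?addr0 => [|j ji].
    apply: le_trans f2s; rewrite -(@iid_Rintegral i (fun y => f y ^+ 2) ((U + `|m|) ^+ 2)) => [//||y].
      exact: measurable_funX.
    by rewrite normrX ler_pXn2r ?nnegrE.
  by apply: (iid_Rintegral_mul _ mf fM f0); rewrite eq_sym.
pose D w := n%:R^-1 * \sum_i Y i w.
have DE w : D w = n%:R^-1 * \sum_i g (xi i w) - m.
  rewrite /D /Y sumrB sumr_const card_ord mulrBr -(mulr_natl m) mulrA mulVf ?mul1r//.
  by rewrite gt_eqF.
pose Q w := n%:R^-1 * \sum_i g (xi i w) ^+ 2.
have mg2x i : measurable_fun setT (fun w => g (xi i w) ^+ 2).
  by apply: measurable_funX; exact: measurableT_comp.
have mSY : measurable_fun setT (fun w => \sum_i Y i w) by apply: measurable_sum => i; exact: mY.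
have mD : measurable_fun setT D by apply: measurable_funM.
have mQ : measurable_fun setT Q.
  by apply: measurable_funM => //; apply: measurable_sum => i; exact: mg2x.
have PD : (Pr [set w | (b ^+ 2 <= D w ^+ 2)%R] <= (1 / 4)%:E)%E.
  apply: (prob_markov (M := (U + `|m|) ^+ 2)).
  - exact: measurable_funX.
  - move=> w; rewrite sqr_ge0 -(@real_normK _ (D w)) ?num_real//.
    rewrite ler_pXn2r ?nnegrE// /D normrM normfV (gtr0_norm nR) ler_pdivrMl//.
    apply: le_trans (ler_norm_sum _ _ _) _.
    by rewrite mulr_natl -[X in _ *+ X]card_ord -sumr_const; exact: ler_sum.
  - by rewrite exprn_gt0.
  have -> : \int[Pr]_w (D w ^+ 2) = n%:R^-2 * \int[Pr]_w ((\sum_i Y i w) ^+ 2).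
    rewrite -RintegralZl//.
      by congr fine; apply: eq_integral => w _; rewrite /D exprMn exprVn.
    apply: (bounded_prob_integrable Pr (M := (n%:R * (U + `|m|)) ^+ 2)) => [|w].
      exact: measurable_funX.
    rewrite normrX ler_pXn2r ?nnegrE ?mulr_ge0//.
    apply: le_trans (ler_norm_sum _ _ _) _.
    by rewrite mulr_natl -[X in _ *+ X]card_ord -sumr_const; exact: ler_sum.
  rewrite ler_pdivrMl ?exprn_gt0//; apply: (le_trans Y2).
  by rewrite expr2 -!mulrA ler_pM2l//; lra.
have PQ : (Pr [set w | (4 * sigma ^+ 2 <= Q w)%R] <= (1 / 4)%:E)%E.
  apply: (prob_markov (M := U ^+ 2)) => //.
  - move=> w; rewrite mulr_ge0 ?sumr_ge0// => [|i _]; last exact: sqr_ge0.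
    rewrite ler_pdivrMl// mulr_natl -[X in _ *+ X]card_ord -sumr_const.
    by apply: ler_sum => i _; apply: le_trans (ler_norm _) _; exact: g2U.
  - by rewrite mulr_gt0 ?exprn_gt0.
  rewrite /Q RintegralZl//; last first.
    apply: (bounded_prob_integrable Pr (M := n%:R * U ^+ 2)) => [|w].
      by apply: measurable_sum => i; exact: mg2x.
    apply: le_trans (ler_norm_sum _ _ _) _.
    by rewrite mulr_natl -[X in _ *+ X]card_ord -sumr_const; exact: ler_sum.
  rewrite (@bounded_Rintegral_sum _ _ _ Pr _ (fun i w => g (xi i w) ^+ 2) (U ^+ 2)) => [|i|i w]; last exact: g2U.
    rewrite ler_pdivrMl//; have -> : n%:R * (1 / 4 * (4 * sigma ^+ 2)) = n%:R * sigma ^+ 2 by lra.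
    rewrite mulr_natl -[X in _ *+ X]card_ord -sumr_const; apply: ler_sum => i _.
    by rewrite (iid_Rintegral i mg2 g2U).
  exact: mg2x.
pose B := [set w | b ^+ 2 <= D w ^+ 2] `|` [set w | 4 * sigma ^+ 2 <= Q w].
have mB1 : measurable [set w | b ^+ 2 <= D w ^+ 2].
  rewrite -[X in measurable X]setTI; apply: measurable_fun_le => //.
  exact: measurable_funX.
have mB2 : measurable [set w | 4 * sigma ^+ 2 <= Q w].
  by rewrite -[X in measurable X]setTI; apply: measurable_fun_le.
have mB : measurable B by exact: measurableU.
exists (~` B); split; first exact: measurableC.
  have PB : (Pr B <= (1 / 2)%:E)%E.
    apply: (le_trans (measureU2 Pr mB1 mB2)).
    apply: (le_trans (leeD PD PQ)); rewrite -EFinD lee_fin; lra.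
  have : Pr B \is a fin_num by exact: fin_num_measure.
  rewrite probability_setC//; move: (Pr B) PB => [r| |]// r2 _.
  by rewrite -EFinB lee_fin; rewrite lee_fin in r2; lra.
move=> w /not_orP[/negP + /negP]; rewrite -!ltNge => Dw Qw; split; last exact: ltW.
rewrite -DE -(@ler_pXn2r _ 2) ?nnegrE ?(ltW b0)// real_normK ?num_real//.
exact: ltW.
Qed.

End empirical_mean.

(** * Empirical measures and nets *)

Section empirical_measure.
Context {R : realType} {dT} {T : measurableType dT}.
Variables (N : nat) (s : nat -> T).

Definition empirical : set T -> \bar R :=
  mscale (N.+1%:R^-1)%:nng (msum (fun k => \d_(s k)) N.+1).

HB.instance Definition _ := Measure.on empirical.

Let empiricalT : empirical setT = 1%E.
Proof.
rewrite /empirical /mscale/= /msum (eq_bigr (fun=> 1%E)) => [|i _]; last exact: diracT.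
rewrite sumEFin sumr_const card_ord -EFinM mulVf//.
Qed.

HB.instance Definition _ := Measure_isProbability.Build _ _ _ empirical empiricalT.

Lemma integral_empirical (f : T -> R) : measurable_fun setT f -> (forall x, 0 <= f x) ->
  (\int[empirical]_x (f x)%:E = (N.+1%:R^-1 * \sum_(k < N.+1) f (s k))%:E)%E.
Proof.
move=> mf f0; have mf' : measurable_fun setT (EFin \o f) by exact/measurable_EFinP.
rewrite /empirical ge0_integral_mscale//; last by move=> x _; rewrite lee_fin.
rewrite ge0_integral_measure_sum//; last by move=> x _; rewrite lee_fin.
rewrite EFinM; congr mule; rewrite -sumEFin; apply: eq_bigr => k _.
by rewrite integral_dirac//; have /= -> := @diracT _ T R (s k); rewrite mul1e.
Qed.

Lemma L2_ball_empirical (f : T -> R) (eta : R) : measurable_fun setT f -> 0 < eta ->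
  (Lnorm empirical 2%:E (fun y => (f y)%:E) < eta%:E)%E ->
  N.+1%:R^-1 * \sum_(k < N.+1) f (s k) ^+ 2 < eta ^+ 2.
Proof.
move=> mf eta0; rewrite unlock /Lnorm.
under eq_integral => y _ do rewrite abse_EFin poweR_EFin powR_mulrn// real_normK ?num_real//.
rewrite integral_empirical; last 2 first.
- exact: measurable_funX.
- by move=> x; exact: sqr_ge0.
set V := _ * _; have V0 : 0 <= V.
  by rewrite mulr_ge0 ?invr_ge0// sumr_ge0// => k _; exact: sqr_ge0.
rewrite poweR_EFin lte_fin powR12_sqrt// => H.
by rewrite -(sqr_sqrtr V0) ltr_pXn2r ?nnegrE ?sqrtr_ge0// ltW.
Qed.

End empirical_measure.

Section kernel_nets.
Context {R : realType} {d n : nat}.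
Variables (K : 'rV[R]_d -> R) (X : set 'rV[R]_d) (l A nu : R).
Hypotheses (mK : measurable_fun setT K) (l0 : 0 < l) (VC : VC_kernel K X l A nu).
Local Notation U := (sup_norm K).
Hypothesis U0 : 0 < U.

Lemma le_sup_norm y : `|K y| <= U.
Proof.
by case: VC => bK _ _ _ _; apply: ub_le_sup => //; exists y.
Qed.

Lemma measurable_scaled_kernel x h : measurable_fun setT (scaled_kernel K x h).
Proof.
apply: measurableT_comp => //; apply: measurable_fun_rV => i.
under eq_fun do rewrite !mxE.
apply: measurable_funM => //; apply: measurable_funB => //.
exact: measurable_coord.
Qed.

Definition damped_kernel x h y := (l / h) ^+ d * scaled_kernel K x h y.

Lemma damping_ge0_le1 h : l <= h -> 0 <= (l / h) ^+ d <= 1.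
Proof.
move=> lh; have h0 := lt_le_trans l0 lh.
have lh0 : 0 <= l / h by rewrite divr_ge0// ltW.
by rewrite exprn_ge0// exprn_ile1// ler_pdivrMr// mul1r.
Qed.

Variable z : bool * 'I_n -> 'rV[R]_d.
Hypothesis n0 : (0 < n)%N.

(** Averaging over [2 * n] points is half of [tot_sqr], whence [2 * eta ^+ 2]. The added 1 makes the
    bound on the infimum strict, so that an actual cover lies below it. Centres belong to the class,
    hence are bounded by [U]. *)
Lemma scaled_kernel_net (eta : R) : 0 < eta < U ->
  exists m (c : 'I_m -> 'rV[R]_d -> R),
  [/\ m%:R <= (A * U / eta) `^ nu + 1, forall j y, `|c j y| <= U &
    forall x h, X x -> l <= h -> exists j,
      tot_sqr (fun p => scaled_kernel K x h (z p) - c j (z p)) <= 2 * eta ^+ 2].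
Proof.
move=> etaU; have [eta0 _] := andP etaU.
pose p0 : bool * 'I_n := (true, Ordinal n0).
pose es := enum {: bool * 'I_n}.
pose s k := z (nth p0 es k).
have ses : size es = (n + n)%N.
  by rewrite -cardE card_prod card_bool card_ord mul2n addnn.
pose N := (n + n).-1; have NE : N.+1 = (n + n)%N by rewrite prednK// addn_gt0 n0.
have [bK _ A0 nu0 /(_ (empirical N s) eta etaU)] := VC.
move=> cov; have : (covering_number (kernel_class K X l) (empirical N s) eta <
    ((A * U / eta) `^ nu + 1)%:E)%E.
  by apply: (le_lt_trans cov); rewrite lte_fin ltrDl.
move=> /ereal_inf_lt[_ [m [c [cF cV]] <-]]; rewrite lte_fin => mA.
exists m, c; split; first exact: ltW.
  move=> j y; have [x [h [_ _ ->]]] := cF j; exact: le_sup_norm.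
move=> x h Xx lh; have [|j] := cV (scaled_kernel K x h); first by exists x, h.
have [xj [hj [_ _ cE]]] := cF j => H; exists j.
pose f y := scaled_kernel K x h y - c j y.
have mf : measurable_fun setT f.
  by apply: measurable_funB; rewrite ?cE; exact: measurable_scaled_kernel.
have := @L2_ball_empirical _ _ _ N s f eta mf eta0 H.
have nR : 0 < n%:R :> R by rewrite ltr0n.
have -> : \sum_(k < N.+1) f (s k) ^+ 2 = n%:R * tot_sqr (fun p => f (z p)).
  rewrite tot_sqrE// NE -ses -(big_mkord xpredT (fun k => f (s k) ^+ 2)).
  rewrite -(big_nth p0 xpredT (fun p => f (z p) ^+ 2)) big_enum/=.
  rewrite (eq_bigr (fun p => f (z (p.1, p.2)) ^+ 2)) => [|[b i] _ //].
  rewrite -(pair_bigA _ (fun b i => f (z (b, i)) ^+ 2))/=.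
  by rewrite big_bool/= addrC -big_split.
rewrite NE natrD => H'.
apply: ltW; rewrite -(ltr_pM2l nR); move: H'.
by rewrite ltr_pdivrMl ?addr_gt0//; move: (tot_sqr _) => t; lra.
Qed.

(** The damping factor is one more parameter in [[0, 1]]: a grid of step below [eta / U] moves each
    value by at most [eta] and contributes the second factor of the count. Both errors together give
    [2 * (2 + 2) = 8]. *)
Lemma damped_kernel_net (eta : R) : 0 < eta < U ->
  exists m (c : 'I_m -> bool * 'I_n -> R),
  [/\ m%:R <= ((A * U / eta) `^ nu + 1) * (U / eta + 2), forall j p, `|c j p| <= U &
    forall v, (exists x h, [/\ X x, l <= h & v = fun p => damped_kernel x h (z p)]) ->
      exists j, tot_sqr (fun p => v p - c j p) <= 8 * eta ^+ 2].
Proof.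
move=> etaU; have [eta0 eU] := andP etaU.
have [m [c [mA cU cV]]] := scaled_kernel_net etaU.
have Ue0 : 0 <= U / eta by rewrite divr_ge0// ltW.
pose q := (Num.trunc (U / eta)).+1.
have q0 : 0 < q%:R :> R by rewrite ltr0n.
have qU : U / eta < q%:R := truncnS_gt _.
pose a (i : 'I_q.+1) : R := i%:R / q%:R.
have a01 i : 0 <= a i <= 1.
  by rewrite /a divr_ge0//= ler_pdivrMr// mul1r ler_nat -ltnS.
pose c' (ij : 'I_q.+1 * 'I_m) p := a ij.1 * c ij.2 (z p).
exists #|{: 'I_q.+1 * 'I_m}|, (fun k => c' (enum_val k)); split.
- rewrite card_prod !card_ord natrM mulrC ler_pM//.
  have : (Num.trunc (U / eta))%:R <= U / eta.
    by have := trunc_itv Ue0; case/andP.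
  by rewrite -[q.+1%:R]natr1 -[q%:R]natr1; lra.
- move=> k p; rewrite /c' normrM -[leRHS]mul1r.
  have /andP[a0 a1] := a01 (enum_val k).1.
  by rewrite ler_pM// ger0_norm.
move=> _ [x [h [Xx lh ->]]].
have [j jV] := cV x h Xx lh.
have /andP[b0 b1] := damping_ge0_le1 lh; set b := (l / h) ^+ d in b0 b1.
have bq0 : 0 <= b * q%:R by rewrite mulr_ge0// ltW.
have iq : (Num.trunc (b * q%:R) < q.+1)%N.
  rewrite ltnS -(ler_nat R); have /andP[H _] := trunc_itv bq0; apply: (le_trans H).
  by rewrite -[leRHS]mul1r ler_pM2r.
pose i := Ordinal iq.
have ba : 0 <= (b - a i) * q%:R <= 1.
  have /andP[H1 H2] := trunc_itv bq0.
  rewrite mulrBl /a/= -mulrA mulVf ?gt_eqF// mulr1; rewrite -natr1 in H2.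
  by apply/andP; split; lra.
exists (enum_rank (i, j)); rewrite enum_rankK /c' /=.
have baU : (b - a i) ^+ 2 * U ^+ 2 <= eta ^+ 2.
  rewrite -exprMn; have /andP[H1 H2] := ba.
  have H3 : 0 <= b - a i by move: H1; rewrite pmulr_lge0.
  rewrite ler_pXn2r ?nnegrE ?mulr_ge0 ?(ltW U0) ?(ltW eta0)//.
  rewrite ltr_pdivrMr// in qU.
  have : (b - a i) * U <= (b - a i) * (q%:R * eta) by rewrite ler_wpM2l// ltW.
  have : (b - a i) * q%:R * eta <= 1 * eta by rewrite ler_wpM2r// ltW.
  by rewrite mulrA; lra.
have /andP[a0 a1] := a01 i.
have n0R : 0 < n%:R :> R by rewrite ltr0n.
have key : tot_sqr (fun p => damped_kernel x h (z p) - a i * c j (z p)) <=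
    2 * (tot_sqr (fun p => (b - a i) * scaled_kernel K x h (z p)) +
         tot_sqr (fun p => a i * (scaled_kernel K x h (z p) - c j (z p)))).
  rewrite (_ : (fun p => damped_kernel _ _ _ - _) = fun p =>
    (b - a i) * scaled_kernel K x h (z p) +
    a i * (scaled_kernel K x h (z p) - c j (z p))); first exact: tot_sqr_le2.
  by apply/funext => p; rewrite /damped_kernel -/b; ring.
apply: (le_trans key).
have k1 : tot_sqr (fun p => (b - a i) * scaled_kernel K x h (z p)) <= 2 * eta ^+ 2.
  rewrite -(ler_pM2l n0R) tot_sqrE//.
  rewrite (_ : n%:R * _ = \sum_(i < n) (eta ^+ 2 + eta ^+ 2)); last first.
    by rewrite sumr_const card_ord -mulr_natl; ring.
  have sq p : ((b - a i) * scaled_kernel K x h (z p)) ^+ 2 <= eta ^+ 2.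
    rewrite exprMn; apply: le_trans baU; rewrite ler_wpM2l ?sqr_ge0//.
    rewrite -(@real_normK _ (scaled_kernel _ _ _ _)) ?num_real//.
    by rewrite ler_pXn2r ?nnegrE ?(ltW U0)//; exact: le_sup_norm.
  by apply: ler_sum => k _; apply: lerD; exact: sq.
have k2 : tot_sqr (fun p => a i * (scaled_kernel K x h (z p) - c j (z p))) <= 2 * eta ^+ 2.
  apply: le_trans jV; rewrite -(ler_pM2l n0R) !tot_sqrE//.
  have sq r : (a i * r) ^+ 2 <= r ^+ 2.
    by rewrite exprMn ler_piMl ?sqr_ge0// exprn_ile1.
  by apply: ler_sum => k _; apply: lerD; exact: sq.
by move: k1 k2; lra.
Qed.

End kernel_nets.

(** * Second moments of the kernel *)

Section euclidean_balls.
Context {R : realType} {d : nat}.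
Implicit Types (x y : 'rV[R]_d).

Lemma enorm_scaled_sub (h : R) x y : 0 < h -> enorm (h^-1 *: (x - y)) = h^-1 * enorm (y - x).
Proof.
move=> h0; rewrite /enorm -[in RHS](ger0_norm (x := h^-1)) ?invr_ge0 ?(ltW h0)// -sqrtr_sqr.
rewrite -sqrtrM ?sqr_ge0// mulr_sumr; congr Num.sqrt; apply: eq_bigr => i _.
by rewrite !mxE; ring.
Qed.

Lemma measurable_eball x r : measurable (eball x r).
Proof.
have mf : measurable_fun setT (fun y => enorm (y - x)).
  rewrite /enorm.
  apply: (@measurableT_comp _ _ _ _ _ _ (@Num.sqrt R)).
    by apply: continuous_measurable_fun; exact: sqrt_continuous.
  apply: measurable_sum => i; apply: measurable_funX.
  under eq_fun do rewrite !mxE.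
  by apply: measurable_funB => //; exact: measurable_coord.
rewrite (_ : eball x r = setT `&` (fun y => enorm (y - x)) @^-1` `]-oo, r[%classic).
  by apply: mf => //; exact: measurable_itv.
by rewrite setTI; apply/seteqP; split=> y; rewrite /eball /= in_itv.
Qed.

End euclidean_balls.

Section ball_growth.
Context {R : realType} {d : nat} (X : set 'rV[R]_d) (P : probability 'rV[R]_d R).

Lemma vol_limsup0_lty : (vol_limsup X P 0 < +oo)%E.
Proof.
apply: (@le_lt_trans _ _ 1%E); last exact: ltry.
rewrite /vol_limsup /limf_esup; set f := fun r : R => _.
apply: (@le_trans _ _ (ereal_sup (f @` setT))).
  by apply: ereal_inf_lbound; exists setT => //; exact: filterT.
apply: ge_ereal_sup => _ [r _ <-]; apply: ge_ereal_sup => _ [x _ <-].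
by rewrite powRr0 invr1 mule1; exact: probability_le1 (measurable_eball _ _).
Qed.

(** The limsup controls only radii below some [e]; for larger ones [P <= 1] is absorbed in the
    constant. *)
Lemma vol_limsup_ball_le (nu : R) : 0 <= nu -> (vol_limsup X P nu < +oo)%E ->
  exists2 c, 0 < c & forall x r, X x -> 0 < r -> (P (eball x r) <= (c * r `^ nu)%:E)%E.
Proof.
move=> nu0 /ereal_inf_lt[_ [V V0 <-] Voo].
have [e /= e0 eV] := V0.
have [c [c0 cV]] : exists c, 0 < c /\ forall x r, X x -> V r ->
    (P (eball x r) * (r `^ nu)^-1%:E <= c%:E)%E.
  set S := ereal_sup _ in Voo.
  exists (Num.max (fine S) 1); split; first by rewrite lt_max ltr01 orbT.
  move=> x r Xx Vr; apply: (@le_trans _ _ S).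
    apply: (@le_trans _ _ (ereal_sup [set P (eball x r) * (r `^ nu)^-1%:E | x in X]))%E.
      by apply: ereal_sup_ubound; exists x.
    by apply: ereal_sup_ubound; exists r.
  case: S Voo => [s| |]// _; rewrite ?leNye// lee_fin /= le_max lexx//.
exists (c + (e / 2) `^ (- nu)); first by rewrite ltr_wpDr// powR_ge0.
move=> x r Xx r0; have rnu : 0 < r `^ nu by exact: powR_gt0.
have [re|er] := ltP r e.
  have Vr : V r by apply: eV => //=; rewrite sub0r normrN gtr0_norm.
  have := cV x r Xx Vr; rewrite -lee_pdivlMr ?invr_gt0// invrK => H.
  apply: (le_trans H); rewrite -EFinM lee_fin ler_pM2r// lerDl powR_ge0//.
apply: (le_trans (probability_le1 P (measurable_eball x r))).
rewrite lee_fin mulrDl; apply: ler_wpDl; first by rewrite mulr_ge0 ?ltW.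
have e2 : 0 < e / 2 by rewrite divr_gt0.
rewrite powRN mulrC ler_pdivlMr ?powR_gt0// mul1r.
apply: ge0_ler_powR => //; rewrite ?nnegrE ?ltW//.
by apply: lt_le_trans er; lra.
Qed.

(** The supremum defining [dvol] need not be attained, hence the loss [eps]. An exponent
    [nu >= dvol - eps] with finite limsup exists; lowering it only weakens the bound for [r <= 1],
    and [P <= 1] settles [r > 1]. *)
Lemma ball_growth (dvol eps : R) : volume_dimension X P = dvol%:E ->
  admissible_eps X P dvol eps ->
  0 <= dvol - eps /\ exists2 c, 0 < c &
    forall x r, X x -> 0 < r -> (P (eball x r) <= (c * r `^ (dvol - eps))%:E)%E.
Proof.
move=> dE adm.
have dvol0 : 0 <= dvol.
  rewrite -lee_fin -dE; apply: ereal_sup_ubound; exists 0 => //.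
  by split=> //; exact: vol_limsup0_lty.
have [nu [nu0 nuoo nud]] : exists nu, [/\ 0 <= nu, (vol_limsup X P nu < +oo)%E &
    dvol - eps <= nu].
  case: adm => [/andP[e0 ed]|[-> [d0|doo]]].
  - have : ((dvol - eps)%:E < volume_dimension X P)%E by rewrite dE lte_fin; lra.
    move=> /ereal_sup_gt[_ [nu [nu0 nuoo] <-]]; rewrite lte_fin => /ltW ?.
    by exists nu.
  - by exists 0; split => //; [exact: vol_limsup0_lty|rewrite d0 subr0].
  - by exists dvol; split=> //; rewrite subr0.
have q0 : 0 <= dvol - eps.
  by case: adm => [/andP[e0 ed]|[-> _]]; lra.
split=> //.
have [c c0 cP] := vol_limsup_ball_le nu0 nuoo.
exists (c + 1) => [|x r Xx r0]; first by rewrite addr_gt0.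
have [r1|r1] := leP r 1.
  apply: (le_trans (cP x r Xx r0)); rewrite lee_fin.
  apply: ler_pM => //; [exact: ltW|exact: powR_ge0|by rewrite lerDl|].
  by apply: ger_powR => //; rewrite r0 r1.
apply: (le_trans (probability_le1 P (measurable_eball x r))).
rewrite lee_fin; apply: (@le_trans _ _ (1 * r `^ (dvol - eps))).
  rewrite mul1r -[leLHS](powRr0 r); apply: ler_powR => //; exact: ltW.
by rewrite ler_wpM2r ?powR_ge0// lerDr ltW.
Qed.

End ball_growth.

Section tail.
Context {R : realType} {d : nat} (K : 'rV[R]_d -> R).
Hypothesis bK : bounded_kernel K.

Lemma tail_has_ubound t : has_ubound [set `|K x| ^+ 2 | x in [set x | t <= enorm x]].
Proof.
have [M MK] := bK; exists (M ^+ 2) => _ [x _ <-].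
have KM : `|K x| <= M by apply: MK; exists x.
by rewrite ler_pXn2r ?nnegrE// (le_trans _ KM).
Qed.

Lemma sqr_le_tail_sup x t : t <= enorm x -> K x ^+ 2 <= tail_sup K t.
Proof.
move=> tx; rewrite -(@real_normK _ (K x)) ?num_real//.
by apply: ub_le_sup; [exact: (@tail_has_ubound t)|exists x => //; rewrite real_normK ?num_real].
Qed.

Lemma tail_sup_ge0 t : 0 <= tail_sup K t.
Proof.
have [[x tx]|nx] := pselect (exists x : 'rV[R]_d, t <= enorm x).
  exact: le_trans (sqr_ge0 (K x)) (sqr_le_tail_sup tx).
(* When [d = 0] and [t > 0] no point has norm at least [t]; the supremum of the empty set is 0 by
   convention. *)
rewrite /tail_sup (_ : [set _ | _ in _] = set0) ?sup0//.
by rewrite -subset0 => y [x tx _]; apply: nx; exists x.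
Qed.

Lemma tail_sup_nonincreasing s t : s <= t -> tail_sup K t <= tail_sup K s.
Proof.
move=> st; have [[x tx]|nx] := pselect (exists x : 'rV[R]_d, t <= enorm x).
  apply: ge_sup; first by exists (`|K x| ^+ 2), x.
  move=> _ [y ty <-]; rewrite real_normK ?num_real//.
  by apply: sqr_le_tail_sup; exact: le_trans st ty.
rewrite [leLHS](_ : _ = 0) ?tail_sup_ge0//.
rewrite /tail_sup (_ : [set _ | _ in _] = set0) ?sup0//.
by rewrite -subset0 => y [x tx _]; apply: nx; exists x.
Qed.

(** Cauchy condensation: [tail_sup] is nonincreasing, so on []2^k / 2, 2^k]] it is at least its
    value at [2^k]. The factor [c0] collects the interval length and the variation of the power
    there. *)
Lemma dyadic_tail_sum_lty (dvol : R) : 0 <= dvol ->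
  (\int[lebesgue_measure]_(t in `]0%R, +oo[) (t `^ (dvol - 1) * tail_sup K t)%:E < +oo)%E ->
  (\sum_(0 <= k <oo) (tail_sup K (2 ^+ k) * (2 ^+ k) `^ dvol)%:E < +oo)%E.
Proof.
move=> dvol0; pose f (t : R) := (t `^ (dvol - 1) * tail_sup K t)%:E.
rewrite -[X in (X < _)%E]/(\int[lebesgue_measure]_(t in `]0%R, +oo[) f t)%E => foo.
pose I k : set R := `](2 ^+ k / 2), (2 ^+ k)]%classic.
have p0 k : 0 < 2 ^+ k :> R by rewrite exprn_gt0.
have mf D : measurable D -> measurable_fun D f.
  move=> mD; apply/measurable_EFinP; apply: measurable_funM.
    by apply: measurable_funTS; exact: measurable_powR.
  by apply: nonincreasing_measurable => // u v uv; exact: tail_sup_nonincreasing.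
have f0 t : (0 <= f t)%E by rewrite lee_fin mulr_ge0 ?powR_ge0 ?tail_sup_ge0.
pose c0 : R := 2 `^ dvol * 2.
have c00 : 0 < c0 by rewrite mulr_gt0 ?powR_gt0.
have step k : ((tail_sup K (2 ^+ k) * (2 ^+ k) `^ dvol)%:E <=
    c0%:E * \int[lebesgue_measure]_(t in I k) f t)%E.
  rewrite -lee_pdivrMl//; have := p0 k; rewrite /I; move: (2 ^+ k) => b b0.
  have bE : b `^ dvol = b * b `^ (dvol - 1).
    rewrite -{2}(powRr1 (ltW b0)) -powRD; first by congr powR; ring.
    by apply/implyP => _; rewrite gt_eqF.
  pose J : set R := `](b / 2), b]%classic.
  apply: (@le_trans _ _ (\int[lebesgue_measure]_(t in J) (cst (2 `^ (- dvol) * (b `^ (dvol - 1) * tail_sup K b))%:E) t)%E).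
    rewrite integral_cst//; last exact: measurable_itv.
    have mJ : lebesgue_measure J = (b - b / 2)%:E.
      by rewrite lebesgue_measure_itv/= lte_fin ltr_pdivrMr// ltr_pMr// ltr1n.
    rewrite [X in (_ <= _ * X)%E]mJ -!EFinM lee_fin /c0 powRN bE.
    rewrite le_eqVlt; apply/orP; left; apply/eqP; field.
    by rewrite gt_eqF ?powR_gt0.
  apply: ge0_le_integral => //; [exact: measurable_itv|by move=> t _; rewrite lee_fin !mulr_ge0 ?powR_ge0 ?tail_sup_ge0|by apply: mf; exact: measurable_itv|].
  move=> t; rewrite /J/= in_itv/= => /andP[bt tb]; rewrite /f lee_fin mulrA.
  have t0 : 0 < t by apply: lt_trans bt; rewrite divr_gt0.
  apply: ler_pM; rewrite ?mulr_ge0 ?powR_ge0 ?tail_sup_ge0//; last exact: tail_sup_nonincreasing.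
  rewrite powRN ler_pdivrMl ?powR_gt0//.
  have bt1 : 1 <= b / t by rewrite ler_pdivlMr// mul1r.
  have -> : b `^ (dvol - 1) = (b / t) `^ (dvol - 1) * t `^ (dvol - 1).
    by rewrite -powRM ?(ltW t0) ?divr_ge0 ?(ltW b0) ?(ltW t0)// divfK// gt_eqF.
  (* Raising the exponent from [dvol - 1] to [dvol] is allowed since [b / t >= 1], and avoids a case
     distinction on the sign of [dvol - 1]. *)
  rewrite ler_wpM2r ?powR_ge0//; apply: (@le_trans _ _ ((b / t) `^ dvol)).
    by apply: ler_powR => //; lra.
  apply: ge0_ler_powR => //; rewrite ?nnegrE ?divr_ge0 ?(ltW b0) ?(ltW t0)//.
  by rewrite ler_pdivrMr//; lra.
apply: (@le_lt_trans _ _ (\sum_(0 <= k <oo) c0%:E * \int[lebesgue_measure]_(t in I k) f t)%E).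
  apply: lee_nneseries => [k _ _|k _]; last exact: step.
  by rewrite lee_fin mulr_ge0 ?powR_ge0 ?tail_sup_ge0.
rewrite nneseriesZl; last by move=> k _; exact: integral_ge0.
have mI k : measurable (I k) by exact: measurable_itv.
rewrite -ge0_integral_bigcup//; last 2 first.
- by apply: mf; apply: bigcup_measurable => k _; exact: mI.
- apply/trivIsetP => i j _ _.
  wlog ij : i j / (i < j)%N.
    move=> H nij; move: (nij); rewrite neq_ltn => /orP[ij|ji]; first exact: H.
    by rewrite setIC; apply: H => //; rewrite eq_sym.
  move=> _; rewrite -subset0 => t []; rewrite /I/= !in_itv/= => /andP[_ ti] /andP[jt _].
  have : 2 ^+ i.+1 <= 2 ^+ j :> R by rewrite ler_weXn2l// ler1n.
  by rewrite exprS => H; have := lt_le_trans jt ti; lra.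
apply: (@le_lt_trans _ _ (c0%:E * \int[lebesgue_measure]_(t in `]0%R, +oo[) f t)%E).
  rewrite lee_pmul2l//; apply: ge0_subset_integral => //.
  - by apply: bigcup_measurable => k _; exact: mI.
  - by apply: mf; exact: measurable_itv.
  move=> t [k _]; rewrite /I/= !in_itv/= => /andP[kt _]; rewrite andbT.
  by apply: lt_trans kt; rewrite divr_gt0.
by rewrite lte_mul_pinfty// lee_fin ltW.
Qed.

End tail.

Lemma dyadic_scale {R : realType} (u : R) : 1 <= u -> exists k, 2 ^+ k <= u < 2 ^+ k.+1.
Proof.
move=> u1; have ex : exists k, u < 2 ^+ k.
  exists (Num.trunc u).+1; apply: (lt_le_trans (truncnS_gt u)).
  by rewrite -natrX ler_nat ltnW// ltn_expl.
case: (ex_minnP ex) => -[|k]; first by rewrite expr0 ltNge u1.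
move=> uk min; exists k; rewrite uk andbT leNgt; apply/negP => /min.
by rewrite ltnn.
Qed.

Lemma second_moment_exists {R : realType} {d : nat} (X : set 'rV[R]_d)
    (P : probability 'rV[R]_d R) (K : 'rV[R]_d -> R) (dvol eps : R) :
  measurable_fun setT K -> volume_dimension X P = dvol%:E ->
  integrable_tail K dvol -> admissible_eps X P dvol eps ->
  exists C2, second_moment_bound K X P dvol eps C2.
Proof.
move=> mK dE [bK tK] adm.
have [q0 [c c0 cP]] := ball_growth dE adm.
have [M MK] := bK.
have KM y : `|K y| <= M by apply: MK; exists y.
have K2M y : K y ^+ 2 <= M ^+ 2.
  rewrite -(@real_normK _ (K y)) ?num_real//.
  by rewrite ler_pXn2r ?nnegrE// (le_trans _ (KM y)).
have mS x h : measurable_fun setT (fun y => (scaled_kernel K x h y ^+ 2)%:E).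
  by apply/measurable_EFinP; apply: measurable_funX; exact: measurable_scaled_kernel.
have eps0 : 0 <= eps by case: adm => [/andP[/ltW]|[->]].
case: tK => [d0|foo].
  (* For [dvol = 0] admissibility forces [eps = 0], so the power of [h] is 1 and boundedness of [K]
     is enough. *)
  have e0 : eps = 0 by case: adm => [/andP[e0 ed]|[]//]; lra.
  exists (M ^+ 2) => x h Xx h0; rewrite d0 e0 subr0 powRr0 mulr1.
  apply: (@le_trans _ _ (\int[P]_y (cst (M ^+ 2)%:E) y)%E).
    apply: ge0_le_integral => //; first by move=> y _; rewrite lee_fin sqr_ge0.
    by move=> y _; rewrite lee_fin; exact: K2M.
  by rewrite integral_cst//; have /= -> := probability_setT P; rewrite mule1.
have dvol0 : 0 <= dvol by lra.
have := dyadic_tail_sum_lty bK dvol0 foo.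
set S := (\sum_(0 <= k <oo) _)%E => Soo.
pose tau k := tail_sup K (2 ^+ k).
have tau0 k : 0 <= tau k by exact: tail_sup_ge0.
have S0 : (0 <= S)%E by apply: nneseries_ge0 => k _ _; rewrite lee_fin mulr_ge0 ?powR_ge0 ?tau0.
have SE : S = (fine S)%:E by rewrite fineK// ge0_fin_numE.
set q := dvol - eps.
exists (c * (M ^+ 2 + 2 `^ q * fine S)) => x h Xx h0.
pose f0 (y : 'rV[R]_d) : \bar R := ((M ^+ 2)%:E * (\1_(eball x h) y)%:E)%E.
(* Whole balls replace annuli in the majorant, as the growth bound concerns balls. *)
pose f k (y : 'rV[R]_d) : \bar R := ((tau k)%:E * (\1_(eball x (h * 2 ^+ k.+1)) y)%:E)%E.
have mI r : measurable_fun setT (fun y : 'rV[R]_d => (\1_(eball x r) y : R)%:E).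
  by apply/measurable_EFinP; apply: measurable_indic; exact: measurable_eball.
have mf0 : measurable_fun setT f0 by exact: measurable_funeM.
have mf k : measurable_fun setT (f k) by exact: measurable_funeM.
have f00 y : (0 <= f0 y)%E by rewrite mule_ge0 ?lee_fin ?sqr_ge0// indicE.
have fk0 k y : (0 <= f k y)%E by rewrite mule_ge0 ?lee_fin ?tau0// indicE.
have iI r : (\int[P]_y (\1_(eball x r) y : R)%:E = P (eball x r))%E.
  by rewrite integral_indic ?setIT//; exact: measurable_eball.
have if0 : (\int[P]_y f0 y <= (c * h `^ q * M ^+ 2)%:E)%E.
  rewrite ge0_integralZl//; last by rewrite lee_fin sqr_ge0.
  rewrite iI (mulrC _ (M ^+ 2)) (EFinM (M ^+ 2)); apply: lee_wpmul2l; first by rewrite lee_fin sqr_ge0.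
  exact: cP.
have ifk k : (\int[P]_y f k y <= (c * h `^ q * 2 `^ q)%:E * (tau k * (2 ^+ k) `^ dvol)%:E)%E.
  rewrite ge0_integralZl//; last by rewrite lee_fin tau0.
  have h2 : 0 < h * 2 ^+ k.+1 by rewrite mulr_gt0// exprn_gt0.
  rewrite iI; apply: (@le_trans _ _ ((tau k)%:E * (c * (h * 2 ^+ k.+1) `^ q)%:E)%E).
    by apply: lee_wpmul2l; [rewrite lee_fin tau0|exact: cP].
  rewrite -!EFinM lee_fin exprS !powRM ?mulr_ge0 ?(ltW h0) ?exprn_ge0//.
  have -> : tau k * (c * (h `^ q * (2 `^ q * (2 ^+ k) `^ q))) =
    c * h `^ q * 2 `^ q * (tau k * (2 ^+ k) `^ q) by ring.
  apply: ler_wpM2l; first by rewrite !mulr_ge0 ?powR_ge0 ?(ltW c0).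
  apply: ler_wpM2l; first exact: tau0.
  (* Only the power of [2 ^+ k] is raised from [q] to [dvol], to match the condensed series; [h]
     keeps the exponent [q]. *)
  by apply: ler_powR; [rewrite exprn_ege1// ler1n|rewrite /q lerBlDr lerDl].
pose g y := (f0 y + \sum_(0 <= k <oo) f k y)%E.
apply: (@le_trans _ _ (\int[P]_y g y)%E).
  apply: ge0_le_integral => //.
  - by move=> y _; rewrite lee_fin sqr_ge0.
  - by apply: emeasurable_funD => //; exact: ge0_emeasurable_sum.
  move=> y _; have s0 : (0 <= \sum_(0 <= k <oo) f k y)%E by apply: nneseries_ge0.
  have eS := enorm_scaled_sub x y h0.
  have [u1|u1] := ltP (enorm (h^-1 *: (x - y))) 1.
    have yB : eball x h y.
      by rewrite /eball/=; move: u1; rewrite eS mulrC ltr_pdivrMr// mul1r.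
    rewrite -[leLHS]adde0; apply: leeD => //.
    by rewrite /f0 indicE mem_set// mule1 lee_fin; exact: K2M.
  have [k /andP[k1 k2]] : exists k, 2 ^+ k <= enorm (h^-1 *: (x - y)) < 2 ^+ k.+1.
    exact: dyadic_scale.
  have yB : eball x (h * 2 ^+ k.+1) y.
    by rewrite /eball/=; move: k2; rewrite eS mulrC ltr_pdivrMr// mulrC.
  rewrite -[leLHS]add0e; apply: leeD => //.
  apply: (@le_trans _ _ (\sum_(0 <= i < k.+1) f i y)%E); last exact: nneseries_lim_ge.
  rewrite big_nat_recr//= -[leLHS]add0e; apply: leeD; first exact: sume_ge0.
  by rewrite /f indicE mem_set// mule1 lee_fin; exact: (sqr_le_tail_sup bK k1).
rewrite ge0_integralD//; last 2 first.
- by move=> y _; apply: nneseries_ge0.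
- exact: ge0_emeasurable_sum.
rewrite integral_nneseries//.
apply: (@le_trans _ _ ((c * h `^ q * M ^+ 2)%:E + (c * h `^ q * 2 `^ q)%:E * S)%E).
  apply: leeD => //; rewrite -nneseriesZl.
    by apply: lee_nneseries => [k _ _|k _]; [exact: integral_ge0|exact: ifk].
  by move=> k _; rewrite lee_fin mulr_ge0 ?powR_ge0 ?tau0.
rewrite SE -EFinM -EFinD lee_fin le_eqVlt; apply/orP; left; apply/eqP; ring.
Qed.

(** * Uniform deviation *)

(** Turns the polynomial count at radius [s / 2 ^+ k.+1] into the geometric form that chaining sums:
    since [r] and [A1] are at least 1, single factors may be replaced by their [k.+1]-st powers. *)
Lemma entropy_bound {R : realType} (A A1 U nu s r : R) (k : nat) :
  0 < A -> 0 < U -> 0 < s -> 0 < nu -> A <= A1 -> 1 <= A1 -> 1 <= r -> U / s <= r ->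
  ((A * U / (s / 2 ^+ k.+1)) `^ nu + 1) * (U / (s / 2 ^+ k.+1) + 2) <=
  (16 * r * (2 * A1 * r) `^ nu) ^+ k.+1.
Proof.
move=> A0 U0 s0 nu0 AA1 A11 r1 Ur.
have r0 : 0 < r by apply: lt_le_trans r1.
have A10 : 0 < A1 by apply: lt_le_trans A11.
have p0 j : 0 < 2 ^+ j :> R by rewrite exprn_gt0.
have p1 j : 1 <= 2 ^+ j :> R by rewrite exprn_ege1// ler1n.
have E : U / (s / 2 ^+ k.+1) = 2 ^+ k.+1 * (U / s).
  by field; rewrite !gt_eqF.
rewrite -(mulrA A) E; set y := 2 * A1 * r.
have y0 : 0 < y by rewrite /y !mulr_gt0.
have y1 : 1 <= y.
  rewrite /y -[leLHS]mulr1 ler_pM//; first by rewrite -[leLHS]mulr1 ler_pM// ler1n.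
have h1 : A * (2 ^+ k.+1 * (U / s)) <= y ^+ k.+1.
  rewrite /y -mulrA exprMn mulrCA ler_pM2l//.
  apply: (@le_trans _ _ (A1 * r)).
    by rewrite ler_pM// ltW// divr_gt0.
  rewrite -[leLHS]expr1; apply: ler_weXn2l => //.
  by rewrite -[leLHS]mulr1 ler_pM.
have h2 : (A * (2 ^+ k.+1 * (U / s))) `^ nu <= (y `^ nu) ^+ k.+1.
  have -> : (y `^ nu) ^+ k.+1 = (y ^+ k.+1) `^ nu.
    by rewrite -(powR_mulrn _ (powR_ge0 _ _)) -(powR_mulrn _ (ltW y0)) powRAC.
  apply: ge0_ler_powR => //; rewrite ?nnegrE; [exact: ltW| |exact: exprn_ge0 (ltW y0)].
  by rewrite !mulr_ge0 ?invr_ge0 ?ltW.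
have y2 : 1 <= (y `^ nu) ^+ k.+1.
  by apply: exprn_ege1; rewrite -(powRr0 y); apply: ler_powR => //; exact: ltW.
have h3 : 2 ^+ k.+1 * (U / s) <= 2 ^+ k.+1 * r by rewrite ler_pM2l.
have h4 : 8 * (2 ^+ k.+1 * r) <= (16 * r) ^+ k.+1.
  have -> : 16 * r = 8 * (2 * r) by ring.
  rewrite exprMn (exprMn k.+1 2 r) ler_pM// ?mulr_ge0 ?exprn_ge0 ?(ltW r0)//.
    by rewrite -[leLHS]expr1 ler_weXn2l// ler1n.
  by rewrite ler_pM2l// -[leLHS]expr1 ler_weXn2l.
have h5 : 1 <= 2 ^+ k.+1 * r by rewrite -[leLHS]mulr1 ler_pM.
rewrite (exprMn k.+1 (16 * r)).
move: h1 h2 h3 h4 h5 y2 (powR_ge0 (A * (2 ^+ k.+1 * (U / s))) nu) (divr_gt0 U0 s0) (p0 k.+1).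
move: ((_ * _) `^ nu) ((y `^ nu) ^+ k.+1) (2 ^+ k.+1 * r) ((16 * r) ^+ k.+1) => Z Y X W.
move: (2 ^+ k.+1) (U / s) => p t _ h2 h3 h4 h5 y2 Z0 t0 p00.
have pt0 : 0 <= p * t by rewrite mulr_ge0 ?ltW.
apply: (@le_trans _ _ ((2 * Y) * (3 * X))).
  by apply: ler_pM; lra.
apply: (@le_trans _ _ (Y * (8 * X))); last by rewrite mulrC ler_pM2r//; lra.
have : 0 <= Y * X by rewrite mulr_ge0; lra.
by lra.
Qed.

Lemma entropy_base_ge1 {R : realType} (A1 r nu : R) : 1 <= A1 -> 1 <= r -> 0 < nu ->
  1 <= 16 * r * (2 * A1 * r) `^ nu.
Proof.
move=> A11 r1 nu0.
have r0 : 0 < r by apply: lt_le_trans r1.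
have A10 : 0 < A1 by apply: lt_le_trans A11.
rewrite -[leLHS]mulr1 ler_pM//.
  by rewrite -[leLHS]mulr1 ler_pM// ler1n.
rewrite -[leLHS](powRr0 (2 * A1 * r)); apply: ler_powR; last exact: ltW.
rewrite -[leLHS]mulr1 ler_pM//.
by rewrite -[leLHS]mulr1 ler_pM// ler1n.
Qed.

Section uniform_deviation.
Context {R : realType} {d n : nat} {disp : measure_display}
  {Omega : measurableType disp} (Pr : probability Omega R)
  (X : set 'rV[R]_d) (P : probability 'rV[R]_d R) (K : 'rV[R]_d -> R)
  (xi : 'I_n -> {RV Pr >-> 'rV[R]_d}) (l A nu : R).
Hypotheses (iidP : iid P xi) (n0 : (0 < n)%N) (mX : measurable X)
  (mK : measurable_fun setT K) (l0 : 0 < l) (VC : VC_kernel K X l A nu).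
Local Notation U := (sup_norm K).
Hypothesis U0 : 0 < U.
Local Notation g := (damped_kernel K l).

Lemma damped_kernel_le_sup x h y : l <= h -> `|g x h y| <= U.
Proof.
move=> lh; have /andP[a0 a1] := damping_ge0_le1 (d := d) l0 lh.
rewrite normrM (ger0_norm a0) -[leRHS]mul1r ler_pM//; exact: (le_sup_norm VC).
Qed.

Lemma measurable_damped_kernel x h : measurable_fun setT (g x h).
Proof. by apply: measurable_funM => //; exact: measurable_scaled_kernel. Qed.

(* A parameter vector is (1/h, x): with 1/h as coordinate no inverse occurs in the kernel. *)
Definition param_kernel (v : 'rV[R]_d.+1) (y : 'rV[R]_d) : R :=
  (l * v ord0 ord0) ^+ d * K (v ord0 ord0 *: ((\row_j v ord0 (lift ord0 j)) - y)).

Definition param (x : 'rV[R]_d) (h : R) : 'rV[R]_d.+1 := rV_cons (h^-1, x).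

Lemma param0 x h : param x h ord0 ord0 = h^-1.
Proof. by rewrite mxE unlift_none. Qed.

Lemma param_lift x h : \row_j param x h ord0 (lift ord0 j) = x.
Proof. by apply/rowP => j; rewrite !mxE liftK. Qed.

Lemma param_kernelE x h : param_kernel (param x h) = g x h.
Proof. by apply/funext => y; rewrite /param_kernel param0 param_lift. Qed.

Local Notation T := (double_sample R d n).

Lemma measurable_param_kernel p :
  measurable_fun setT (fun zv : T * 'rV[R]_d.+1 => param_kernel zv.2 (zv.1 p)).
Proof.
have mc i : measurable_fun setT (fun zv : T * 'rV[R]_d.+1 => zv.2 ord0 i).
  by apply: (measurableT_comp (measurable_coord i)); exact: measurable_snd.
apply: measurable_funM.
  by apply: measurable_funX; apply: measurable_funM.
apply: measurableT_comp => //; apply: measurable_fun_rV => i.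
rewrite (_ : (fun _ => _) = fun zv : T * 'rV[R]_d.+1 =>
  zv.2 ord0 ord0 * (zv.2 ord0 (lift ord0 i) - zv.1 p ord0 i)); last first.
  by apply/funext => zv; rewrite !mxE.
apply: measurable_funM => //; apply: measurable_funB => //.
apply: (measurableT_comp (measurable_coord i)).
by apply: (measurableT_comp (measurable_eval p)); exact: measurable_fst.
Qed.

Definition bad_pair (sigma theta : R) : set (T * 'rV[R]_d.+1) :=
  [set zv : T * 'rV[R]_d.+1 | X (\row_j zv.2 ord0 (lift ord0 j))] `&`
  [set zv : T * 'rV[R]_d.+1 | 0 < zv.2 ord0 ord0] `&` [set zv : T * 'rV[R]_d.+1 | zv.2 ord0 ord0 <= l^-1] `&`
  [set zv : T * 'rV[R]_d.+1 | 5 / 2 * theta < `|avg false (fun p => param_kernel zv.2 (zv.1 p)) -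
     avg true (fun p => param_kernel zv.2 (zv.1 p))|] `&`
  [set zv : T * 'rV[R]_d.+1 | avg_sqr true (fun p => param_kernel zv.2 (zv.1 p)) <= 4 * sigma ^+ 2].

Lemma measurable_bad_pair sigma theta : measurable (bad_pair sigma theta).
Proof.
have mc i : measurable_fun setT (fun zv : T * 'rV[R]_d.+1 => zv.2 ord0 i).
  by apply: (measurableT_comp (measurable_coord i)); exact: measurable_snd.
have mavg b (F : T * 'rV[R]_d.+1 -> bool * 'I_n -> R) :
    (forall p, measurable_fun setT (fun zv => F zv p)) ->
    measurable_fun setT (fun zv => avg b (F zv)).
  by move=> mF; apply: measurable_funM => //; apply: measurable_sum => i; exact: mF.
have mk := measurable_param_kernel.
have mle (f h : T * 'rV[R]_d.+1 -> R) : measurable_fun setT f -> measurable_fun setT h ->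
    measurable [set zv | f zv <= h zv].
  by move=> mf mh; rewrite -[X in measurable X]setTI; exact: measurable_fun_le.
have mlt (f h : T * 'rV[R]_d.+1 -> R) : measurable_fun setT f -> measurable_fun setT h ->
    measurable [set zv | f zv < h zv].
  move=> mf mh; rewrite (_ : [set zv | _] = ~` [set zv | h zv <= f zv]).
    by apply: measurableC; exact: mle.
  by apply/seteqP; split=> zv /=; [move=> fh; apply/negP; rewrite -ltNge|move=> /negP; rewrite -ltNge].
rewrite /bad_pair.
apply: measurableI; [apply: measurableI; [apply: measurableI; [apply: measurableI|]|]|].
- have mr : measurable_fun setT (fun zv : T * 'rV[R]_d.+1 => \row_j zv.2 ord0 (lift ord0 j)).
    apply: measurable_fun_rV => i.
    rewrite (_ : (fun _ => _) = fun zv : T * 'rV[R]_d.+1 => zv.2 ord0 (lift ord0 i)) ?mc//.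
    by apply/funext => zv; rewrite mxE.
  by have := mr measurableT _ mX; rewrite setTI.
- exact: mlt.
- exact: mle.
- by apply: mlt => //; apply: measurableT_comp => //; apply: measurable_funB; exact: mavg.
- apply: mle => //; apply: mavg => p.
  by apply: measurable_funX; exact: mk.
Qed.

Variables (A1 r sigma delta : R).
Hypotheses (AA1 : A <= A1) (A11 : 1 <= A1) (r1 : 1 <= r) (sigma0 : 0 < sigma)
  (rU : U / sigma <= r) (delta01 : 0 < delta < 1).
Hypothesis sigmaP : forall x h, X x -> l <= h -> \int[P]_y (g x h y ^+ 2) <= sigma ^+ 2.
Let M := 16 * r * (2 * A1 * r) `^ nu.
Variables L S theta : R.
Hypotheses (LE : L = 3 * ln M + ln (24 / delta)) (S64 : 64 * sigma ^+ 2 <= S)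
  (SU : 64 * U ^+ 2 * L <= n%:R * S)
  (theta0 : 0 < theta) (thetaS : 320 * S * L <= n%:R * theta ^+ 2).

Let M1 : 1 <= M.
Proof. by apply: entropy_base_ge1 => //; case: VC. Qed.

Let L12 : 1 / 2 <= L.
Proof.
have [d0 d1] := andP delta01.
have lnM : 0 <= ln M by exact: ln_ge0.
have e0 : 0 < 24 / delta by rewrite divr_gt0.
have := expR_ge1Dx (- ln (24 / delta)).
rewrite expRN lnK ?posrE// invf_div => H.
have : delta / 24 <= 1 / 24 by rewrite ler_pM2r ?invr_gt0// ltW.
by rewrite LE; lra.
Qed.

Let expL : M ^+ 3 * expR (- L) = delta / 24.
Proof.
have [d0 d1] := andP delta01.
have M0 : 0 < M by apply: lt_le_trans M1.
have e0 : 0 < 24 / delta by rewrite divr_gt0.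
rewrite LE opprD expRD expRN [ln (24 / delta)]lock expRN -lock lnK ?posrE//.
rewrite expRM_natl lnK ?posrE// mulrA divff ?mul1r ?invf_div//.
by rewrite expf_neq0// gt_eqF.
Qed.

Lemma uniform_deviation : exists H, [/\ measurable H, (Pr H <= delta%:E)%E &
  forall w, ~ H w -> forall x h, X x -> l <= h ->
    `|n%:R^-1 * \sum_i g x h (xi i w) - \int[P]_y g x h y| <= 5 * theta].
Proof.
have [d0 d1] := andP delta01.
have nR : 0 < n%:R :> R by rewrite ltr0n.
pose Bad w := exists x h, [/\ X x, l <= h &
   5 * theta < `|n%:R^-1 * \sum_i g x h (xi i w) - \int[P]_y g x h y|].
suff [H [mH BH PH]] : exists H, [/\ measurable H, Bad `<=` H & (Pr H <= (2 * (delta / 2))%:E)%E].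
  exists H; split=> //; first by move: PH; rewrite mulrC divfK.
  move=> w nH x h Xx lh; rewrite leNgt; apply/negP => lt; apply: nH; apply: BH.
  by exists x, h.
apply: (symmetrization iidP (measurable_bad_pair sigma theta) (e := delta / 4)).
- by lra.
- move=> z.
  pose V := [set v : bool * 'I_n -> R | exists x h, [/\ X x, l <= h & v = fun p => g x h (z p)]].
  have s0 : 0 < Num.min sigma U by rewrite lt_min sigma0.
  have net k : exists m (c : 'I_m -> bool * 'I_n -> R),
      [/\ m%:R <= M ^+ k.+1, forall j p, `|c j p| <= U &
        forall v, V v -> exists j, tot_sqr (fun p => v p - c j p) <= 2 * sigma ^+ 2 / 4 ^+ k].
    (* The minimum with [U] keeps [eta] in the range of the VC condition; the extra halving turns
       [8 * eta ^+ 2] into at most [2 * sigma ^+ 2 / 4 ^+ k]. *)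
    pose eta := Num.min sigma U / 2 ^+ k.+1.
    have p1 : 1 <= 2 ^+ k :> R by rewrite exprn_ege1// ler1n.
    have p0 : 0 < 2 ^+ k :> R by rewrite exprn_gt0.
    have etaU : 0 < eta < U.
      rewrite divr_gt0 ?exprn_gt0//= /eta ltr_pdivrMr ?exprn_gt0//.
      apply: (@le_lt_trans _ _ U); first by rewrite ge_min lexx orbT.
      by rewrite ltr_pMr// exprS; lra.
    have [m [c [mA cU cV]]] := damped_kernel_net mK l0 VC U0 z n0 etaU.
    exists m, c; split=> //.
      apply: (le_trans mA); apply: entropy_bound => //; try by case: VC.
      rewrite ler_pdivrMr//; have [su|us] := leP sigma U.
        by rewrite -ler_pdivrMr.
      by rewrite ler_pMl.
    move=> v Vv; have [j cj] := cV v Vv; exists j; apply: (le_trans cj).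
    have e2 : eta ^+ 2 <= sigma ^+ 2 / (4 * 4 ^+ k).
      rewrite /eta expr_div_n -exprM mulnC exprM -exprS.
      have -> : 2 ^+ 2 = 4 :> R by ring.
      apply: ler_wpM2r; first by rewrite invr_ge0 exprn_ge0.
      by rewrite ler_pXn2r ?nnegrE ?(ltW s0) ?(ltW sigma0)// ge_min lexx.
    by move: e2; rewrite invfM; lra.
  have L0 : 0 < L by move: L12; lra.
  have := sign_deviation_bound n0 U0 sigma0 M1 net L0 S64 SU theta0 thetaS.
  rewrite expL => /(_ ltac:(lra)) H.
  apply: (@le_trans _ _ (6 * (delta / 24))); last by lra.
  apply: le_trans H; apply: le_sign_frac => s [v [[[[Xv v0] vl] vt] vs]] /=.
  exists (fun p => param_kernel v (z p)); last by split.
  exists (\row_j v ord0 (lift ord0 j)), (v ord0 ord0)^-1; split=> //.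
    by rewrite -[l]invrK lef_pV2 ?posrE ?invr_gt0//.
  by apply/funext => p; rewrite /param_kernel /damped_kernel /scaled_kernel invrK.
- move=> w [x [h [Xx lh xw]]].
  have h0 := lt_le_trans l0 lh.
  (* Chebyshev's requirement for the ghost sample follows from [thetaS] because [L >= 1 / 2]. Half
     of the deviation [5 * theta] is given to the ghost mean, the other half is left to the
     signs. *)
  have nt : 4 * sigma ^+ 2 <= n%:R * (5 / 2 * theta) ^+ 2.
    have SL : S * (1 / 2) <= S * L by apply: ler_wpM2l => //; have := sqr_ge0 sigma; move: S64; lra.
    have -> : n%:R * (5 / 2 * theta) ^+ 2 = 25 / 4 * (n%:R * theta ^+ 2) by field.
    move: S64 thetaS SL; rewrite -(mulrA 320).
    by move: (S * L) (sigma ^+ 2) (sqr_ge0 sigma) (n%:R * theta ^+ 2) => u v v0 t; lra.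
  have t50 : 0 < 5 / 2 * theta by rewrite mulr_gt0.
  have [G [mG G2 GP]] := empirical_moments_half iidP n0 (measurable_damped_kernel x h)
    (fun y => damped_kernel_le_sup x y lh) sigma0 (sigmaP Xx lh) t50 nt.
  exists (param x h), G; split=> // w' /GP[G1 G3].
  rewrite /bad_pair /= param_kernelE param0 param_lift.
  split; last exact: G3.
  split.
    split; last by rewrite lef_pV2 ?posrE.
    by split=> //; rewrite /= invr_gt0.
  rewrite /=; move: xw G1; rewrite /avg /pair_sample/=.
  move: (n%:R^-1 * \sum_i g x h (xi i w)) (n%:R^-1 * \sum_i g x h (xi i w')).
  move: (\int[P]_y _) => c a b ab bc.
  rewrite -(@ltrD2r _ (`|b - c|)); apply: (@lt_le_trans _ _ `|a - c|); first by lra.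
  by apply: le_trans (ler_normD _ _); rewrite addrA subrK.
Qed.

End uniform_deviation.

(** * Rate *)

Section rate.
Context {R : realType}.

Lemma sqrtrD_le (a b : R) : 0 <= a -> 0 <= b -> Num.sqrt (a + b) <= Num.sqrt a + Num.sqrt b.
Proof.
move=> a0 b0.
rewrite -(@ler_pXn2r _ 2) ?nnegrE ?addr_ge0 ?sqrtr_ge0//.
rewrite sqr_sqrtr ?addr_ge0// sqrrD !sqr_sqrtr//.
have : 0 <= Num.sqrt a * Num.sqrt b by rewrite mulr_ge0 ?sqrtr_ge0.
by rewrite mulr2n; lra.
Qed.

Lemma ln_ge1B (x : R) : 0 < x -> 1 - x^-1 <= ln x.
Proof.
move=> x0; have := expR_ge1Dx (- ln x).
by rewrite expRN lnK ?posrE//; lra.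
Qed.

(** The factor 2 comes from [1 <= 2 * ln (2 / delta)], which absorbs the additive constants of [L]
    into the confidence term. *)
Definition log_const (A nu q : R) : R :=
  2 * (3 * ln 16 + 3 * nu * ln (2 * Num.max A 1) + ln 12) + 3 * (1 + nu) * (q / 2) + 1.

(** 5 is the multiple of [theta] in the deviation bound, and [320 * 64] combines the constants
    relating [theta] to [S] and [S] to the second moment. *)
Definition rate_const (A U : R) (d : nat) (nu dvol C2 eps : R) : R :=
  let c := log_const A nu (dvol - eps) in
  5 * Num.sqrt (320 * 64) * (Num.sqrt (Num.max C2 (U ^+ 2) * c) + U * c).

Lemma ln_max1_ge0 (A : R) : 0 <= ln (2 * Num.max A 1).
Proof.
apply: ln_ge0; rewrite -[leLHS]mulr1 ler_pM// ?ler1n// le_max lexx orbT//.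
Qed.

Lemma log_const_gt0 (A nu q : R) : 0 < nu -> 0 <= q -> 0 < log_const A nu q.
Proof.
move=> nu0 q0; rewrite /log_const.
have h1 : 0 <= ln 16 :> R by apply: ln_ge0; rewrite ler1n.
have h2 : 0 <= ln 12 :> R by apply: ln_ge0; rewrite ler1n.
have h3 : 0 <= nu * ln (2 * Num.max A 1) by rewrite mulr_ge0 ?ln_max1_ge0 ?ltW.
have h4 : 0 <= (1 + nu) * (q / 2) by rewrite mulr_ge0 ?divr_ge0//; lra.
by rewrite -!mulrA; lra.
Qed.

Lemma log_level_le (A nu q x delta : R) : 0 < nu -> 0 <= q -> 0 <= x -> 0 < delta < 1 ->
  3 * ln (16 * expR (q / 2 * x) * (2 * Num.max A 1 * expR (q / 2 * x)) `^ nu) +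
    ln (24 / delta) <= log_const A nu q * (x + ln (2 / delta)).
Proof.
move=> nu0 q0 x0 /andP[d0 d1].
have A10 : 0 < 2 * Num.max A 1 by rewrite mulr_gt0// lt_max ltr01 orbT.
have e0 : 0 < expR (q / 2 * x) by exact: expR_gt0.
have p16 : 0 < 16 * expR (q / 2 * x) by rewrite mulr_gt0.
have pnu : 0 < (2 * Num.max A 1 * expR (q / 2 * x)) `^ nu by apply: powR_gt0; exact: mulr_gt0.
have lnMp (u v : R) : 0 < u -> 0 < v -> ln (u * v) = ln u + ln v.
  by move=> u0 v0; rewrite lnM ?posrE.
rewrite (lnMp _ _ p16 pnu) ln_powR (lnMp _ _ _ e0)// (lnMp _ _ A10 e0) expRK.
have -> : 24 / delta = 12 * (2 / delta) by field; rewrite gt_eqF.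
rewrite (lnMp 12) ?divr_gt0//.
have D2 : 1 / 2 <= ln (2 / delta).
  have := @ln_ge1B (2 / delta); rewrite divr_gt0// invf_div => /(_ isT).
  have : delta / 2 <= 1 / 2 by rewrite ler_pM2r// ltW.
  by lra.
have h1 : 0 <= ln 16 :> R by apply: ln_ge0; rewrite ler1n.
have h2 : 0 <= ln 12 :> R by apply: ln_ge0; rewrite ler1n.
have := ln_max1_ge0 A; rewrite /log_const.
move: (ln (2 * _)) (ln 16) (ln 12) (ln (2 / delta)) D2 h1 h2 => a b c D D2 h1 h2 a0.
have na0 : 0 <= nu * a by rewrite mulr_ge0// ltW.
set s := 3 * b + 3 * nu * a + c.
have s0 : 0 <= s by rewrite /s -mulrA; lra.
have t0 : 0 <= (1 + nu) * (q / 2) by rewrite mulr_ge0 ?divr_ge0//; lra.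
have k1 : 0 <= s * (2 * D - 1) by rewrite mulr_ge0//; lra.
have k2 : 0 <= s * x by rewrite mulr_ge0.
have k3 : 0 <= (1 + nu) * (q / 2) * D by rewrite mulr_ge0//; lra.
have -> : 3 * (b + q / 2 * x + nu * (a + q / 2 * x)) + (c + D) =
  s + 3 * ((1 + nu) * (q / 2)) * x + D by rewrite /s; field.
have -> : (2 * s + 3 * (1 + nu) * (q / 2) + 1) * (x + D) =
  2 * (s * x) + 2 * (s * D) + 3 * ((1 + nu) * (q / 2)) * x +
  3 * ((1 + nu) * (q / 2) * D) + x + D by field.
by move: k1; rewrite mulrBr mulr1; lra.
Qed.

(** Subadditivity of the square root is used twice: to separate the variance part of [S] from its
    range part, then the entropy [w1] from the confidence [w2]. *)
Lemma rate_arith (U sigma2 L n l : R) (d : nat) (w1 w2 c N2 C2 : R) :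
  0 <= U -> 0 <= sigma2 -> 0 < n -> 0 < l -> 0 <= L -> 0 <= w1 -> 0 <= w2 -> 0 <= c ->
  L <= c * (w1 + w2) -> 0 < N2 -> 0 <= C2 -> sigma2 / (l ^+ d) ^+ 2 = C2 * n / N2 ->
  Num.sqrt (320 * (64 * sigma2 + 64 * U ^+ 2 * L / n) * L / n) / l ^+ d <=
  Num.sqrt (320 * 64) * (Num.sqrt (C2 * c) + U * c) *
   (w1 / (n * l ^+ d) + Num.sqrt (w1 / N2) + Num.sqrt (w2 / N2) + w2 / (n * l ^+ d)).
Proof.
move=> U0 s0 n0 l0 L0 w10 w20 c0 Lc N20 C20 sE.
have ld0 : 0 < l ^+ d by rewrite exprn_gt0.
set k := Num.sqrt (320 * 64).
set N1 := n * l ^+ d; have N10 : 0 < N1 by rewrite mulr_gt0.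
have e1 : Num.sqrt (320 * (64 * sigma2 + 64 * U ^+ 2 * L / n) * L / n) =
    k * Num.sqrt (sigma2 * (L / n) + (U * (L / n)) ^+ 2).
  rewrite -sqrtrM; last by apply: mulr_ge0; exact: ler0n.
  by congr Num.sqrt; field; rewrite gt_eqF.
have Ln0 : 0 <= L / n by rewrite divr_ge0// ltW.
have q1 : 0 <= sigma2 * (L / n) by apply: mulr_ge0.
have e2 : Num.sqrt (sigma2 * (L / n) + (U * (L / n)) ^+ 2) <=
    Num.sqrt (sigma2 * (L / n)) + U * (L / n).
  apply: (le_trans (sqrtrD_le q1 (sqr_ge0 _))).
  by rewrite sqrtr_sqr ger0_norm// mulr_ge0.
have e3 : Num.sqrt (sigma2 * (L / n)) / l ^+ d <=
    Num.sqrt (C2 * c) * (Num.sqrt (w1 / N2) + Num.sqrt (w2 / N2)).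
  have -> : Num.sqrt (sigma2 * (L / n)) / l ^+ d = Num.sqrt (C2 * (L / N2)).
    have -> : (l ^+ d)^-1 = Num.sqrt (((l ^+ d) ^+ 2)^-1).
      by rewrite -(exprVn (l ^+ d)) sqrtr_sqr ger0_norm// invr_ge0 ltW.
    rewrite -sqrtrM; last exact: q1.
    congr Num.sqrt.
    have -> : sigma2 * (L / n) / (l ^+ d) ^+ 2 = sigma2 / (l ^+ d) ^+ 2 * (L / n) by ring.
    by rewrite sE; field; rewrite !gt_eqF.
  apply: (@le_trans _ _ (Num.sqrt (C2 * c * (w1 / N2 + w2 / N2)))).
    rewrite ler_wsqrtr// -mulrA; apply: ler_wpM2l => //.
    rewrite -mulrDl mulrA; apply: ler_wpM2r => //.
    by rewrite invr_ge0 ltW.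
  rewrite sqrtrM ?mulr_ge0//; apply: ler_wpM2l; first exact: sqrtr_ge0.
  by apply: sqrtrD_le; rewrite divr_ge0// ltW.
have e4 : U * (L / n) / l ^+ d <= U * c * (w1 / N1 + w2 / N1).
  have -> : U * (L / n) / l ^+ d = U * (L / N1) by rewrite /N1; field; rewrite !gt_eqF.
  rewrite -mulrA; apply: ler_wpM2l => //; rewrite -mulrDl mulrA; apply: ler_wpM2r => //.
  by rewrite invr_ge0 ltW.
rewrite e1 -!mulrA; apply: ler_wpM2l; first exact: sqrtr_ge0.
apply: (@le_trans _ _ ((Num.sqrt (sigma2 * (L / n)) + U * (L / n)) / l ^+ d)).
  by apply: ler_wpM2r => //; rewrite invr_ge0 ltW.
rewrite mulrDl; apply: (le_trans (lerD e3 e4)).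
have := sqrtr_ge0 (w1 / N2); have := sqrtr_ge0 (w2 / N2).
have : 0 <= w1 / N1 by rewrite divr_ge0// ltW.
have : 0 <= w2 / N1 by rewrite divr_ge0// ltW.
have := sqrtr_ge0 (C2 * c); have : 0 <= U * c by rewrite mulr_ge0.
move: (Num.sqrt (w1 / N2)) (Num.sqrt (w2 / N2)) (w1 / N1) (w2 / N1).
move: (Num.sqrt (C2 * c)) (U * c) => a b x y z t b0 a0 t0 z0 y0 x0.
have := mulr_ge0 a0 z0; have := mulr_ge0 a0 t0.
by have := mulr_ge0 b0 x0; have := mulr_ge0 b0 y0; nra.
Qed.

End rate.

(** * From the damped empirical process to the density estimator *)

Section kde_deviation.
Context {R : realType} {d n : nat} {disp : measure_display}
  {Omega : measurableType disp} (Pr : probability Omega R)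
  (P : probability 'rV[R]_d R) (K : 'rV[R]_d -> R)
  (xi : 'I_n -> {RV Pr >-> 'rV[R]_d}) (l : R).
Hypotheses (iidP : iid P xi) (n0 : (0 < n)%N) (mK : measurable_fun setT K) (l0 : 0 < l).

Lemma kde_sub_meanE (U : R) x h w : (forall y, `|K y| <= U) -> l <= h ->
  kde K xi h x w - mean_kde K xi h x =
  (n%:R^-1 * \sum_i damped_kernel K l x h (xi i w) -
   \int[P]_y damped_kernel K l x h y) / l ^+ d.
Proof.
move=> KU lh; have h0 := lt_le_trans l0 lh.
have nR : 0 < n%:R :> R by rewrite ltr0n.
have mS := measurable_scaled_kernel mK x h.
have SU y : `|scaled_kernel K x h y| <= U by exact: KU.
have msum : measurable_fun setT (fun w' => \sum_i scaled_kernel K x h (xi i w')).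
  by apply: measurable_sum => i; exact: measurableT_comp.
have Isum : Pr.-integrable setT (EFin \o (fun w' => \sum_i scaled_kernel K x h (xi i w'))).
  apply: (bounded_prob_integrable Pr (M := n%:R * U)) => // w'.
  apply: le_trans (ler_norm_sum _ _ _) _.
  by rewrite mulr_natl -[X in _ *+ X]card_ord -sumr_const; apply: ler_sum => i _; exact: SU.
have -> : mean_kde K xi h x = (h ^+ d)^-1 * \int[P]_y scaled_kernel K x h y.
  rewrite /mean_kde unlock.
  transitivity (\int[Pr]_w' ((n%:R * h ^+ d)^-1 * \sum_i scaled_kernel K x h (xi i w'))); first by [].
  rewrite RintegralZl//.
  rewrite (@bounded_Rintegral_sum _ _ _ Pr _ (fun i w' => scaled_kernel K x h (xi i w')) U).
  - rewrite (eq_bigr (fun=> \int[P]_y scaled_kernel K x h y)) => [|i _].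
      by rewrite sumr_const card_ord -mulr_natl; field; rewrite !gt_eqF ?exprn_gt0.
    exact: (iid_Rintegral iidP i mS SU).
  - by move=> i; exact: measurableT_comp.
  - by move=> i w'; exact: SU.
have -> : \int[P]_y damped_kernel K l x h y = (l / h) ^+ d * \int[P]_y scaled_kernel K x h y.
  rewrite -RintegralZl//; exact: bounded_prob_integrable mS SU.
rewrite /kde /damped_kernel -mulr_sumr expr_div_n.
by field; rewrite !gt_eqF ?exprn_gt0.
Qed.

End kde_deviation.

Lemma damped_sqr_le {R : realType} {d : nat} (X : set 'rV[R]_d)
    (P : probability 'rV[R]_d R) (K : 'rV[R]_d -> R) (dvol eps C2 B U l : R) x h :
  measurable_fun setT K -> (forall y, `|K y| <= U) ->
  second_moment_bound K X P dvol eps C2 -> 0 <= 2 * d%:R - dvol + eps ->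
  C2 <= B -> 0 <= B -> 0 < l -> X x -> l <= h ->
  \int[P]_y (damped_kernel K l x h y ^+ 2) <= B * l `^ (dvol - eps).
Proof.
move=> mK KU C2P a0 CB B0 l0 Xx lh; have h0 := lt_le_trans l0 lh.
have mS : measurable_fun setT (fun y => scaled_kernel K x h y ^+ 2).
  by apply: measurable_funX; exact: measurable_scaled_kernel.
have SU y : `|scaled_kernel K x h y ^+ 2| <= U ^+ 2.
  by rewrite normrX ler_pXn2r ?nnegrE// ?KU// (le_trans _ (KU 0)).
have Ii := bounded_prob_integrable P mS SU.
have -> : \int[P]_y (damped_kernel K l x h y ^+ 2) =
    ((l / h) ^+ d) ^+ 2 * \int[P]_y (scaled_kernel K x h y ^+ 2).
  rewrite -RintegralZl//; congr fine; apply: eq_integral => y _.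
  by rewrite /damped_kernel exprMn.
have C2h : \int[P]_y (scaled_kernel K x h y ^+ 2) <= C2 * h `^ (dvol - eps).
  rewrite -lee_fin fineK; first exact: C2P.
  exact: (integrable_fin_num measurableT Ii).
have lh0 : 0 < l / h by rewrite divr_gt0.
(* The squared damping splits in two: one power is at most 1, the other converts [h] to the power
   [dvol - eps] into the same power of [l]. *)
have -> : ((l / h) ^+ d) ^+ 2 =
    (l / h) `^ (2 * d%:R - dvol + eps) * (l / h) `^ (dvol - eps).
  rewrite -powRD; last by apply/implyP => _; rewrite gt_eqF.
  have -> : 2 * d%:R - dvol + eps + (dvol - eps) = (d * 2)%:R.
    by rewrite natrM; ring.
  by rewrite powR_mulrn ?(ltW lh0)// exprM.
have lh1 : (l / h) `^ (2 * d%:R - dvol + eps) <= 1.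
  rewrite -[leRHS](powRr0 (l / h)); apply: ger_powR => //.
  by rewrite lh0 ler_pdivrMr// mul1r.
have -> : l `^ (dvol - eps) = (l / h) `^ (dvol - eps) * h `^ (dvol - eps).
  by rewrite -powRM ?divfK ?gt_eqF// ltW.
rewrite -mulrA mulrCA.
apply: (@le_trans _ _ (1 * ((l / h) `^ (dvol - eps) * \int[P]_y (scaled_kernel K x h y ^+ 2)))).
  rewrite mulrCA; apply: ler_wpM2r => //.
  by rewrite mulr_ge0 ?powR_ge0// Rintegral_ge0// => y _; exact: sqr_ge0.
rewrite mul1r mulrCA; apply: ler_wpM2l; first exact: powR_ge0.
by apply: (le_trans C2h); apply: ler_wpM2r; first exact: powR_ge0.
Qed.

Theorem theorem12 (R : realType) :
  exists C : forall (A Kinf : R) (d : nat) (nu dvol C2 eps : R), R,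
  forall (d : nat) (X : set 'rV[R]_d) (P : probability 'rV[R]_d R)
    (K : 'rV[R]_d -> R) (dvol eps : R),
  measurable X ->
  measurable_fun setT K ->
  volume_dimension X P = dvol%:E ->
  integrable_tail K dvol ->
  admissible_eps X P dvol eps ->
  0 <= 2 * d%:R - dvol + eps ->
  (exists C2 : R, second_moment_bound K X P dvol eps C2) /\
  (forall C2 : R, second_moment_bound K X P dvol eps C2 ->
   forall (n : nat) (l delta A nu : R)
     (disp : measure_display) (Omega : measurableType disp)
     (Pr : probability Omega R) (xi : 'I_n -> {RV Pr >-> 'rV[R]_d}),
   (0 < n)%N -> 0 < l -> 0 < delta < 1 ->
   iid P xi ->
   VC_kernel K X l A nu ->
   with_probability_at_least (Pr := Pr) (1 - delta)
     [set w | (kde_sup_deviation K X l xi w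
       <= (C A (sup_norm K) d nu dvol C2 eps
            * kde_rate d dvol eps n l delta)%:E)%E]).
Proof.
exists rate_const => d X P K dvol eps mX mK dE tK adm a0.
split; first exact: second_moment_exists dE tK adm.
have [q0 _] := ball_growth dE adm.
move=> C2 C2P n l delta A nu disp Omega Pr xi n0 l0 delta01 iidP VC.
have [d0 d1] := andP delta01.
set U := sup_norm K; set q := dvol - eps in q0.
have KU := le_sup_norm VC; rewrite -/U in KU.
have [bK _ A0 nu0 _] := VC.
have nR : 0 < n%:R :> R by rewrite ltr0n.
have U0 : 0 <= U := le_trans (normr_ge0 _) (KU 0).
pose c := log_const A nu q; have c0 : 0 < c by exact: log_const_gt0.
pose w1 := Num.max (ln l^-1) 0; pose w2 := ln (2 / delta).
have w10 : 0 <= w1 by rewrite le_max lexx orbT.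
have w20 : 0 <= w2.
  by apply: ln_ge0; rewrite ler_pdivlMr// mul1r; lra.
pose N2 := n%:R * l `^ (2 * d%:R - dvol + eps).
have N20 : 0 < N2 by rewrite mulr_gt0// powR_gt0.
have ld0 : 0 < l ^+ d by rewrite exprn_gt0.
pose B := Num.max C2 (U ^+ 2).
have B0 : 0 <= B by rewrite le_max sqr_ge0 orbT.
have BE : B * l `^ q / (l ^+ d) ^+ 2 = B * n%:R / N2.
  have -> : (l ^+ d) ^+ 2 = l `^ (2 * d%:R - dvol + eps) * l `^ q.
    rewrite -powRD; last by apply/implyP => _; rewrite gt_eqF.
    have -> : 2 * d%:R - dvol + eps + q = (d * 2)%:R by rewrite natrM /q; ring.
    by rewrite powR_mulrn ?(ltW l0)// exprM.
  by rewrite /N2; field; rewrite !gt_eqF ?powR_gt0.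
have CE : rate_const A U d nu dvol C2 eps * kde_rate d dvol eps n l delta =
  5 * (Num.sqrt (320 * 64) * (Num.sqrt (B * c) + U * c) *
   (w1 / (n%:R * l ^+ d) + Num.sqrt (w1 / N2) + Num.sqrt (w2 / N2) + w2 / (n%:R * l ^+ d))).
  by rewrite /rate_const /kde_rate -/w1 -/w2 -/N2 -/q -/c -/B !mulrA.
suff [H [mH PH HB]] : exists H, [/\ measurable H, (Pr H <= delta%:E)%E &
    forall w, ~ H w -> forall x h, X x -> l <= h ->
    `|n%:R^-1 * \sum_i damped_kernel K l x h (xi i w) -
      \int[P]_y damped_kernel K l x h y| / l ^+ d <=
     rate_const A U d nu dvol C2 eps * kde_rate d dvol eps n l delta].
  exists (~` H); split; first exact: measurableC.
    move=> w Hw /=; apply: ge_ereal_sup => _ [[x h] [/= Xx lh] <-].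
    rewrite lee_fin (kde_sub_meanE iidP n0 mK l0 x w KU lh).
    by rewrite normrM normfV (gtr0_norm ld0); exact: HB.
  have : Pr H \is a fin_num by exact: fin_num_measure.
  rewrite probability_setC//; move: (Pr H) PH => [r| |]// rd _.
  by rewrite -EFinB lee_fin; rewrite lee_fin in rd; lra.
(* If [U = 0] the VC condition says nothing, its range of radii being empty, but then [K] vanishes
   identically. *)
have [Ue|Un] := eqVneq U 0.
  exists set0; split=> //; first by rewrite measure0 lee_fin ltW.
  move=> w _ x h Xx lh.
  have K0 y : K y = 0 by apply/eqP; rewrite -normr_eq0 eq_le normr_ge0 andbT -Ue.
  have g0 y : damped_kernel K l x h y = 0 by rewrite /damped_kernel /scaled_kernel K0 mulr0.
  rewrite big1 ?mulr0//.
  rewrite (_ : \int[P]_y _ = 0); last first.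
    by rewrite /Rintegral (eq_integral (cst 0%E)) ?integral0// => y _; rewrite g0.
  rewrite subrr normr0 mul0r CE; apply: mulr_ge0; first exact: ler0n.
  apply: mulr_ge0.
    apply: mulr_ge0; first exact: sqrtr_ge0.
    by rewrite addr_ge0 ?sqrtr_ge0// mulr_ge0// ltW.
  by rewrite !addr_ge0 ?sqrtr_ge0// divr_ge0// mulr_ge0// ltW.
have Up : 0 < U by rewrite lt_def Un.
have Bp : 0 < B by rewrite lt_max exprn_gt0 ?orbT.
pose r := expR (q / 2 * w1); pose sigma := Num.sqrt (B * l `^ q).
have sp : 0 < B * l `^ q by rewrite mulr_gt0 ?powR_gt0.
have sigma0 : 0 < sigma by rewrite sqrtr_gt0.
have sigma2 : sigma ^+ 2 = B * l `^ q by rewrite sqr_sqrtr// ltW.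
have r1 : 1 <= r.
  by rewrite -(expR0 R) ler_expR mulr_ge0// divr_ge0.
(* After squaring, this holds because [B >= U ^+ 2] and [expR (q * w1)] is at least [l] to the power
   [- q]. *)
have rU : U / sigma <= r.
  rewrite ler_pdivrMr// -(@ler_pXn2r _ 2) ?nnegrE ?mulr_ge0 ?expR_ge0 ?sqrtr_ge0//.
  rewrite exprMn sigma2 /r -expRM_natl.
  have -> : expR (2%:R * (q / 2 * w1)) = expR (q * w1) by congr expR; field.
  rewrite mulrCA -[leLHS]mulr1; apply: ler_pM => //; first exact: sqr_ge0.
    by rewrite le_max lexx orbT.
  rewrite /powR (gt_eqF l0) -expRD -(expR0 R) ler_expR -mulrDr mulr_ge0//.
  have : ln l^-1 <= w1 by rewrite le_max lexx.
  by rewrite lnV ?posrE//; lra.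
pose A1 := Num.max A 1.
have A11 : 1 <= A1 by rewrite le_max lexx orbT.
pose M := 16 * r * (2 * A1 * r) `^ nu.
pose L := 3 * ln M + ln (24 / delta).
(* The sum meets both lower bounds required of [S], and [theta] then attains equality in its own
   constraint. *)
pose S := 64 * sigma ^+ 2 + 64 * U ^+ 2 * L / n%:R.
pose theta := Num.sqrt (320 * S * L / n%:R).
have Lc : L <= c * (w1 + w2) by exact: log_level_le.
have L0 : 0 < L.
  have := ln_ge1B (x := 24 / delta); rewrite divr_gt0// invf_div => /(_ isT).
  have : delta / 24 <= 1 / 24 by rewrite ler_pM2r ?invr_gt0// ltW.
  have : 0 <= ln M by apply: ln_ge0; exact: entropy_base_ge1 A11 r1 nu0.
  by rewrite /L; lra.
have UL : 0 <= U ^+ 2 * L by rewrite mulr_ge0 ?sqr_ge0 ?(ltW L0).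
have S0 : 0 < S.
  have -> : S = 64 * sigma ^+ 2 + 64 * (U ^+ 2 * L / n%:R) by rewrite /S; ring.
  have := exprn_gt0 2 sigma0; have : 0 <= U ^+ 2 * L / n%:R by rewrite divr_ge0// ltW.
  by lra.
have tp : 0 < 320 * S * L / n%:R.
  have -> : 320 * S * L / n%:R = 320 * (S * L / n%:R) by ring.
  have : 0 < S * L / n%:R by rewrite divr_gt0// mulr_gt0.
  by lra.
have [H [mH PH HB]] : exists H, [/\ measurable H, (Pr H <= delta%:E)%E &
    forall w, ~ H w -> forall x h, X x -> l <= h ->
    `|n%:R^-1 * \sum_i damped_kernel K l x h (xi i w) -
      \int[P]_y damped_kernel K l x h y| <= 5 * theta].
  apply: (@uniform_deviation _ _ _ _ _ Pr X P K xi l A nu iidP n0 mX mK l0 VC Up A1 r sigma delta _ A11 r1 sigma0 rU delta01 _ L S theta (erefl _)).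
  - by rewrite le_max lexx.
  - move=> x h Xx lh; rewrite sigma2; apply: (damped_sqr_le mK KU C2P) => //.
    by rewrite le_max lexx.
  - rewrite lerDl -mulrA; apply: mulr_ge0; last by rewrite divr_ge0// ltW.
    by apply: mulr_ge0; [exact: ler0n|exact: sqr_ge0].
  - have -> : n%:R * S = 64 * (n%:R * sigma ^+ 2) + 64 * U ^+ 2 * L.
      by rewrite /S; field; rewrite gt_eqF.
    by rewrite lerDr mulr_ge0 ?ler0n// ltW// mulr_gt0// exprn_gt0.
  - by rewrite sqrtr_gt0.
  - by rewrite sqr_sqrtr ?(ltW tp)// (mulrC n%:R) divfK// gt_eqF.
exists H; split=> // w nH x h Xx lh.
apply: (@le_trans _ _ (5 * (theta / l ^+ d))).
  by rewrite mulrA; apply: ler_wpM2r; [rewrite invr_ge0 ltW|exact: HB].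
rewrite CE; apply: ler_wpM2l => //.
rewrite /theta /S sigma2; apply: rate_arith => //; exact: ltW.
Qed.
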